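(* Let $n=p_1^{a_1}\cdots p_r^{a_r}$ with $p_1,\ldots,p_r$ distinct primes. Let $G,H$ be regular abelian permutation groups of degree $n$ (on the same set) with $G$ cyclic, let $G_{p_i},H_{p_i}$ be Sylow $p_i$-subgroups of $G$ and $H$ respectively, and let $\Gamma$ be a Cayley digraph on $G$ (so that $G\le{\rm Aut}(\Gamma)$ acting regularly on the vertices). If $\Gamma$ is of product type $\Gamma_1,\ldots,\Gamma_r$, where each $\Gamma_i$ is a Cayley digraph on both $G_{p_i}$ and a group isomorphic to $H_{p_i}$ ($1\le i\le r$), then $\Gamma$ is isomorphic to a Cayley digraph of $H$. Furthermore, the converse holds whenever $G,H\le N\le{\rm Aut}(\Gamma)$ for some nilpotent group $N$: in that case $\Gamma$ is of product type $\Gamma_1,\ldots,\Gamma_r$ with each $\Gamma_i$ a Cayley digraph on both $G_{p_i}$ and a group isomorphic to $H_{p_i}$, and moreover each ${\rm Aut}(\Gamma_i)$ is a (possibly trivial) multiwreath product of cyclic groups.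
   Context: For a group $G$ and $S\subseteq G$, the Cayley digraph ${\rm Cay}(G,S)$ has vertex set $G$ and arc set $\{(g,gs):g\in G,s\in S\}$. A digraph $\Gamma$ is of product type $\Gamma_1,\ldots,\Gamma_r$ if ${\rm Aut}(\Gamma_1)\times\cdots\times{\rm Aut}(\Gamma_r)\le{\rm Aut}(\Gamma)$, i.e. under an identification of $V(\Gamma)$ with $V(\Gamma_1)\times\cdots\times V(\Gamma_r)$ the direct product acting coordinatewise consists of automorphisms of $\Gamma$. For permutation groups $A$ on $X$ and $B$ on $Y$, the wreath product $A\wr B$ is the set of permutations of $X\times Y$ of the form $(x,y)\mapsto(a(x),b_x(y))$ with $a\in A$ and $b_x\in B$ for each $x\in X$; a multiwreath product is an iterated wreath product $A_1\wr A_2\wr\cdots\wr A_m$ (cyclic groups acting regularly). *)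

(* Defs.v *)
From HB Require Import structures.
From mathcomp Require Import all_boot all_fingroup all_solvable.

Set Implicit Arguments.
Unset Strict Implicit.
Unset Printing Implicit Defensive.

Import GroupScope.

(* Loops are allowed: the connection set of a Cayley digraph may contain 1. *)
Record digraph := Digraph { vertex : finType; arc : rel vertex }.

Definition digraph_iso (D1 D2 : digraph) : Prop :=
  exists2 f : vertex D1 -> vertex D2,
    bijective f & forall x y, arc (f x) (f y) = arc x y.

Section DigraphAut.
Variable D : digraph.

Definition digraph_aut : {set {perm vertex D}} :=
  [set s : {perm vertex D} | [forall x, forall y, arc (s x) (s y) == arc x y]].

Lemma digraph_autP (s : {perm vertex D}) :
  reflect (forall x y, arc (s x) (s y) = arc x y) (s \in digraph_aut).
Proof.
rewrite inE; apply: (iffP forallP) => h x.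
  by move=> y; apply/eqP; apply: (forallP (h x)).
by apply/forallP => y; apply/eqP.
Qed.

Lemma digraph_aut_group_set : group_set digraph_aut.
Proof.
apply/group_setP; split=> [|s t /digraph_autP hs /digraph_autP ht].
  by apply/digraph_autP => x y; rewrite !perm1.
by apply/digraph_autP => x y; rewrite !permM ht hs.
Qed.

Canonical digraph_aut_group := Group digraph_aut_group_set.

End DigraphAut.

Definition Cay (gT : finGroupType) (G : {group gT}) (S : {set gT}) : digraph :=
  @Digraph (subg_of G) (fun x y => [exists s in S, sgval y == sgval x * s]).

Definition cayley_digraph_on (gT : finGroupType) (G : {group gT})
    (D : digraph) : Prop :=
  exists2 S : {set gT}, S \subset G & digraph_iso (Cay G S) D.

(* phi identifies the product of the vertex sets with the vertex set of D. *)
Definition product_type (r : nat) (D : digraph) (Ds : 'I_r -> digraph) : Prop :=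
  exists2 phi : {dffun forall i : 'I_r, vertex (Ds i)} -> vertex D,
    bijective phi &
    forall a : (forall i : 'I_r, {perm vertex (Ds i)}),
      (forall i, a i \in digraph_aut (Ds i)) ->
      forall x y : {dffun forall i : 'I_r, vertex (Ds i)},
        arc (phi [ffun i => a i (x i)]) (phi [ffun i => a i (y i)])
        = arc (phi x) (phi y).

Definition regular_permgroup (X : finType) (A : {group {perm X}}) : Prop :=
  [transitive A, on [set: X] | 'P] /\ (forall x : X, 'C_A[x | 'P] = 1).

Definition wreath (X Y : finType) (A : {set {perm X}}) (B : {set {perm Y}}) :
    {set {perm X * Y}} :=
  [set s : {perm X * Y} |
    [exists a in A, exists b : {ffun X -> {perm Y}},
      [forall x, b x \in B] && [forall z, s z == (a z.1, b z.1 z.2)]]].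

Inductive iterated_wreath_cyclic :
    forall X : finType, {set {perm X}} -> Prop :=
| IterWreathOne (X : finType) (A : {group {perm X}}) :
    cyclic A -> regular_permgroup A -> iterated_wreath_cyclic A
| IterWreathCons (X Y : finType) (A : {group {perm X}}) (B : {set {perm Y}}) :
    cyclic A -> regular_permgroup A -> iterated_wreath_cyclic B ->
    iterated_wreath_cyclic (wreath A B).

Definition permgroup_iso (X Y : finType) (A : {set {perm X}})
    (B : {set {perm Y}}) : Prop :=
  exists2 f : X -> Y, bijective f &
    forall (s : {perm X}) (t : {perm Y}),
      (forall x, t (f x) = f (s x)) -> (s \in A) = (t \in B).

Definition multiwreath_of_cyclic (X : finType) (A : {set {perm X}}) : Prop :=
  exists (Y : finType) (B : {set {perm Y}}),
    iterated_wreath_cyclic B /\ permgroup_iso A B.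

Definition cayley_product_type (V : finType) (r : nat) (D : digraph)
    (Gp Hp : 'I_r -> {group {perm V}}) (Ds : 'I_r -> digraph) : Prop :=
  product_type D Ds /\
  forall i : 'I_r,
    cayley_digraph_on (Gp i) (Ds i) /\
    exists (gT : finGroupType) (K : {group gT}),
      K \isog Hp i /\ cayley_digraph_on K (Ds i).

(* Main.v *)
(** For the converse, split the nilpotent group N into its Sylow subgroups; this
reduces everything to a p-group P with point stabiliser S and two complements
of S: G cyclic and H abelian. The key fact is local: if <y> S = P and
H / (H :&: S) is not cyclic, then the suborbit S y S is invariant under
multiplying y by the elements k of <y> with k^p in S. Indeed, in the faithful
case the normaliser of <y> meets S in a nontrivial p-group acting on <y>, which
contains y |-> y^(1 + #[y]/p) unless p = 2 and P is dihedral or semidihedral,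
and then P has no noncyclic abelian subgroup of index 2. Along a chain
S = Q_0 < ... < Q_a = P with indices p, cut at every s for which
(H :&: Q_(s+1)) / (H :&: Q_(s-1)) is not cyclic. The factors of G and H between
consecutive cuts are cyclic, and by the key fact the orbitals of P are invariant
under the corresponding multiwreath product W of cyclic groups. Finally W is
the automorphism group of an iterated lexicographic product of directed cycles,
which is a Cayley digraph of any abelian group having such a chain.

For the direct implication, the translations by the H_(p_i) on the factors
generate a regular copy of H in the automorphism group. *)

From mathcomp Require Import all_boot all_fingroup all_solvable.
From mathcomp Require Import zify.
Require Import Defs.

Set Implicit Arguments.
Unset Strict Implicit.
Unset Printing Implicit Defensive.

Import GroupScope.

(** * The key fact on double cosets in p-groups *)

Lemma expn_1add_cubic (d n : nat) :
  exists X, ((1 + d) ^ n = 1 + n * d + 'C(n, 2) * d ^ 2 + d ^ 3 * X)%N.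
Proof.
elim: n => [|n [X IHn]]; first by exists 0%N; rewrite muln0.
exists (X * (1 + d) + 'C(n, 2))%N; rewrite expnS IHn binS bin1.
rewrite !expnS expn0 !muln1; lia.
Qed.

(** In the binomial expansion the linear term is [p ^ v.+1 * c], and the later terms are divisible
    by [p ^ v.+2]: the quadratic one because [p] divides ['C(p, 2)] for odd [p], and because
    [2 * v >= v + 2] when [1 < v]. *)
Lemma expn_prime_1add (p v c : nat) :
    prime p -> 0 < v -> odd p || (1 < v) -> coprime p c ->
  exists2 c', coprime p c' & ((1 + p ^ v * c) ^ p = 1 + p ^ v.+1 * c')%N.
Proof.
move=> p_pr v_gt0 odd_or_v co_pc; have [X ->] := expn_1add_cubic (p ^ v * c) p.
have copD e : coprime p (c + p * e).
  by rewrite /coprime addnC mulnC gcdnMDl.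
case: v v_gt0 odd_or_v => // v _ odd_or_v.
case: (even_prime p_pr) => [p2|p_odd].
  case: v odd_or_v => [|v _]; first by rewrite p2.
  subst p; exists (c + 2 * (2 ^ v * c ^ 2 + 2 ^ v * 2 ^ v.+2 * c ^ 3 * X))%N => //.
  rewrite binn !expnS expn0; nia.
have [e De] : exists e, ('C(p, 2) = p * e)%N.
  exists ('C(p, 2) %/ p)%N; rewrite mulnC divnK // prime_dvd_bin //=.
  exact: odd_prime_gt2.
exists (c + p * (p ^ v * e * c ^ 2 + p ^ v * p ^ v * c ^ 3 * X))%N => //.
rewrite De !expnS expn0; nia.
Qed.

Lemma expn_primepow_1add (p v c j : nat) :
    prime p -> 0 < v -> odd p || (1 < v) -> coprime p c ->
  exists2 c', coprime p c' & ((1 + p ^ v * c) ^ (p ^ j) = 1 + p ^ (v + j) * c')%N.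
Proof.
move=> p_pr v_gt0 odd_or_v co_pc; elim: j => [|j [c1 co_c1 IHj]].
  by exists c => //; rewrite addn0 expn1.
rewrite expnSr expnM IHj addnS; apply: expn_prime_1add => //.
  by rewrite addn_gt0 v_gt0.
case/orP: odd_or_v => [-> //|lt1v]; apply/orP; right.
exact: leq_trans lt1v (leq_addr _ _).
Qed.

Definition dcoset_rel (gT : finGroupType) (S : {set gT}) (y z : gT) : Prop :=
  exists s t, [/\ s \in S, t \in S & z = s * y * t].

Lemma conjg_cycle_expn (gT : finGroupType) (y u : gT) (m j : nat) :
  y ^ u = y ^+ m -> y ^ (u ^+ j) = y ^+ (m ^ j).
Proof.
move=> yu; elim: j => [|j IHj]; first by rewrite conjg1.
by rewrite expgSr conjgM IHj conjXg yu -expgM -expnS.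
Qed.

Section CorefreeDoubleCoset.

Variables (gT : finGroupType) (p : nat) (P S H : {group gT}) (y k : gT).
Hypotheses (pP : p.-group P) (yP : <[y]> * S = P) (sHP : H \subset P).
Hypotheses (oH : #|H| = #[y]) (abH : abelian H) (ncH : ~~ cyclic H).
Hypothesis (faithful_S : 'C_S[y] = 1).
Hypotheses (ky : k \in <[y]>) (kp : k ^+ p = 1).

Let N := 'N_P(<[y]>).
Let A := S :&: N.

Let sSP : S \subset P.
Proof. by rewrite -yP mulG_subr. Qed.

Let syP : <[y]> \subset P.
Proof. by rewrite -yP mulG_subl. Qed.

Let sGN : <[y]> \subset N.
Proof. by rewrite subsetI syP normG. Qed.

Let defN : <[y]> * A = N.
Proof. by rewrite /A group_modl // yP; apply/setIidPr/subsetIl. Qed.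

Let y_neq1 : y != 1.
Proof.
apply: contraNneq ncH => y1; move: oH; rewrite y1 order1 => /eqP.
by rewrite -trivg_card1 => /eqP->; apply: cyclic1.
Qed.

Let py : p.-elt y.
Proof. by apply: mem_p_elt pP _; rewrite -cycle_subG. Qed.

Let p_pr : prime p.
Proof.
have nt_y : <[y]> :!=: 1 by rewrite cycle_eq1.
by have [] := pgroup_pdiv (pgroupS syP pP) nt_y.
Qed.

Let a := logn p #[y].

Let oy : #[y] = (p ^ a)%N.
Proof. exact: (card_pgroup (pgroupS syP pP)). Qed.

Let a_gt0 : 0 < a.
Proof. by rewrite lt0n; apply: contraNneq y_neq1 => a0; rewrite -order_eq1 oy a0. Qed.

Let z := y ^+ (p ^ a.-1).

Let oz : #[z] = p.
Proof.
rewrite orderXdiv oy; last by rewrite dvdn_exp2l ?leq_pred.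
by rewrite -{1}(prednK a_gt0) expnS mulnK // expn_gt0 prime_gt0.
Qed.

(** [<[z]>] is characteristic in [<[y]>], hence normal in the p-group [N], and a normal subgroup of
    order [p] of a p-group is central. *)
Let z_central (u : gT) : u \in N -> z ^ u = z.
Proof.
move=> Nu; have nzN : <[z]> <| N.
  apply: (char_normal_trans (H := <[y]>)); last by rewrite normalSG.
  exact: cycle_subgroup_char (cycleX _ _).
have pN : p.-group N := pgroupS (subsetIl _ _) pP.
have ntz : <[z]> :!=: 1 by rewrite cycle_eq1 -order_gt1 oz prime_gt1.
have zZ := meet_center_nil (pgroup_nil pN) nzN ntz.
have /subsetP/(_ z (cycle_id z)) : <[z]> \subset 'Z(N).
  by apply: prime_meetG zZ; rewrite -orderE oz.
by case/centerP=> _ /(_ u Nu) czu; rewrite conjgE czu mulKg.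
Qed.

(** The bound [v < a] expresses that [u] does not centralise [y], and [0 < v] that [u] fixes [z]. *)
Let A_exp (u : gT) : u \in A -> u != 1 ->
  exists v c, [/\ 0 < v < a, coprime p c & y ^ u = y ^+ (1 + p ^ v * c)].
Proof.
case/setIP=> Su Nu ntu; have /cycleP[m yum] : y ^ u \in <[y]>.
  by case/setIP: Nu => _ /normP<-; rewrite memJ_conjg cycle_id.
(* The order of [y] is added so that the predecessor is a true subtraction even for [m = 0]. *)
pose d := (m + #[y]).-1; have Dd : (1 + d = m + #[y])%N.
  by rewrite add1n prednK // addn_gt0 order_gt0 orbT.
have yud : y ^ u = y ^+ (1 + d) by rewrite Dd expgD expg_order mulg1.
have nd : ~~ (#[y] %| d).
  apply: contra ntu; rewrite order_dvdn => /eqP yd.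
  rewrite -in_set1 -[[set 1]]faithful_S inE Su; apply/cent1P.
  by rewrite /commute (conjgC y) yud expgD yd mulg1.
have d_gt0 : 0 < d by case: (posnP d) nd => // ->; rewrite dvdn0.
have [c co_pc Dc] := pfactor_coprime p_pr d_gt0.
exists (logn p d), c; split=> //; last by rewrite mulnC -Dc.
rewrite -pfactor_dvdn // -[X in _ && X]negbK -leqNgt -pfactor_dvdn // -oy.
rewrite nd andbT expn1 -oz order_dvdn; have := z_central Nu.
rewrite /z conjXg yud -expgM mulnC mulnDr muln1 expgD expgM -/z.
by move/eqP; rewrite -[X in _ == X]mulg1 (inj_eq (mulgI z)).
Qed.

(** Here [y ^ u = y * z ^+ c] with [z] fixed by [u], so conjugating [y] by powers of [u] multiplies
    it by every power of [z ^+ c]; these exhaust the subgroup of order [p] of [<[y]>], which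
    contains [k]. *)
Let exp_pred_done (u : gT) (c : nat) :
    u \in A -> coprime p c -> y ^ u = y ^+ (1 + p ^ a.-1 * c) ->
  dcoset_rel S y (y * k).
Proof.
case/setIP=> Su Nu co_pc yu.
have kz : k \in <[z ^+ c]>.
  have <- : <[z]> = <[z ^+ c]>.
    by apply/eqP; rewrite -/(generator _ _) generator_coprime oz.
  case/cycleP: ky kp => j -> /eqP; rewrite -expgM -order_dvdn oy.
  rewrite -{1}(prednK a_gt0) expnSr dvdn_pmul2r ?prime_gt0 //.
  by case/dvdnP=> i ->; rewrite mulnC expgM mem_cycle.
case/cycleP: kz => i ->; exists (u ^- i), (u ^+ i); split.
- by rewrite groupV groupX.
- by rewrite groupX.
rewrite -mulgA -conjgE; elim: i => [|i IHi]; first by rewrite conjg1 mulg1.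
rewrite [u ^+ _]expgSr conjgM -IHi conjMg conjXg yu expgD expgM -/z conjXg.
rewrite z_central //.
by rewrite expg1 -mulgA -expgS.
Qed.

Let exp_power_done (u : gT) (v c : nat) : u \in A -> 0 < v < a -> coprime p c ->
    odd p || (1 < v) -> y ^ u = y ^+ (1 + p ^ v * c) -> dcoset_rel S y (y * k).
Proof.
move=> Au /andP[v_gt0 ltva] co_pc odd_or_v yu.
have [c' co_pc' Dc'] := expn_primepow_1add (a.-1 - v) p_pr v_gt0 odd_or_v co_pc.
apply: (exp_pred_done (groupX (p ^ (a.-1 - v)) Au) co_pc').
by rewrite (conjg_cycle_expn _ yu) Dc' subnKC // -ltnS prednK.
Qed.

Lemma corefree_dcoset : dcoset_rel S y (y * k).
Proof.
have nilP := pgroup_nil pP.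
have prGP : <[y]> \proper P.
  rewrite properE syP; apply: contra ncH => sPy.
  exact: cyclicS (subset_trans sHP sPy) (cycle_cyclic y).
(* Normalisers grow in the p-group [P], so the proper subgroup [<[y]>] is normalised by a nontrivial
   element of [S]. *)
have prGN : <[y]> \proper N := nilpotent_proper_norm nilP prGP.
have /trivgPn[u Au ntu] : A :!=: 1.
  by apply: contraTneq prGN => A1; rewrite -defN A1 mulg1 properxx.
have [v [c [v_bd co_pc yu]]] := A_exp Au ntu.
have [ov|] := boolP (odd p || (1 < v)); first exact: exp_power_done yu.
rewrite negb_or => /andP[even_p v_le1].
have p2 : p = 2 by case: (even_prime p_pr) => // odd_p; rewrite odd_p in even_p.
have v1 : v = 1%N by move: v_bd v_le1; clear; lia.
have [a2|a_neq2] := eqVneq a 2.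
  by apply: (exp_pred_done Au co_pc); rewrite a2 yu v1.
have a_ge3 : 2 < a by move: v_bd a_neq2; rewrite v1; clear; lia.
(* Exceptional case: if no power of u works, then every nontrivial element of A
   acts as an exponent congruent to 3 mod 4, so A = {1, u}. *)
have le1_eq w : 0 < w < a -> ~~ (odd p || (1 < w)) -> w = 1%N.
  by rewrite negb_or -leqNgt; case: w => [|[|w]] // _ /andP[].
have [/exists_inP[w Aw /andP[ntw ntuw]] | noA] :=
  boolP [exists w in A, (w != 1) && (u * w != 1)].
  have [v2 [c2 [v2_bd co_pc2 yw]]] := A_exp Aw ntw.
  have [ov2|v2_le1] := boolP (odd p || (1 < v2)); first exact: exp_power_done yw.
  have [v3 [c3 [v3_bd co_pc3 yuw]]] := A_exp (groupM Au Aw) ntuw.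
  have [ov3|v3_le1] := boolP (odd p || (1 < v3)).
    exact: exp_power_done (groupM Au Aw) v3_bd co_pc3 ov3 yuw.
  have v21 : v2 = 1%N by apply: le1_eq v2_bd v2_le1.
  have v31 : v3 = 1%N by apply: le1_eq v3_bd v3_le1.
  (* Modulo 4 the product of two exponents congruent to 3 is 1, so [u * w] cannot have such an
     exponent too. *)
  move/eqP: yuw; rewrite conjgM yu conjXg yw -expgM eq_expg_mod_order.
  have d4 : 4 %| #[y] by rewrite oy p2; exact: (@dvdn_exp2l 2 2 a (ltnW a_ge3)).
  move/eqP/(congr1 (modn^~ 4)); rewrite !modn_dvdm // v1 v21 v31 p2.
  move: co_pc co_pc2 co_pc3; rewrite p2 !coprime2n; clear; lia.
have uu : u * u = 1.
  apply/eqP; apply: contraNT noA => uu; apply/exists_inP; exists u => //.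
  by rewrite ntu.
have A_u w : w \in A -> w = 1 \/ w = u.
  move=> Aw; case: (eqVneq w 1) => [|ntw]; [by left | right].
  apply/(mulgI u); rewrite uu; apply/eqP; apply: contraNT noA => uw.
  by apply/exists_inP; exists w => //; rewrite ntw.
set m := (1 + p ^ v * c)%N in yu.
(* [m] squares to 1 modulo [2 ^ a] and [m = 1 + 2 * c] with [c] odd, so [2 ^ a] divides
   [4 * (c * c.+1)]. Thus [m] is -1 modulo [2 ^ a.-1]: the dihedral or semidihedral action. *)
have dv_m1 : 2 ^ a.-1 %| m.+1.
  have /eqP : y ^+ (m * m) = y ^+ 1.
    by rewrite expgM -yu -conjXg -yu -conjgM uu conjg1 expg1.
  rewrite eq_expg_mod_order oy p2 /m v1 p2 => /eqP mm.
  have : 2 ^ a %| 4 * (c * c.+1).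
    have -> : (4 * (c * c.+1) = (1 + 2 ^ 1 * c) * (1 + 2 ^ 1 * c) - 1)%N by clear; nia.
    by rewrite -eqn_mod_dvd ?mm; [exact/eqP | clear; nia].
  rewrite -(subnKC (ltnW a_ge3 : 2 <= a)) expnD dvdn_pmul2l // Gauss_dvdr; last first.
    by rewrite coprime_pexpl ?subn_gt0 // -p2.
  move=> dv_c1; have -> : (1 + 2 ^ 1 * c).+1 = (2 * c.+1)%N by clear; lia.
  by rewrite add2n /= expnS dvdn_pmul2l.
have y2u : (y ^+ 2) ^ u = y ^- 2.
  apply/eqP; rewrite eq_sym eq_invg_mul conjXg yu -expgM -expgD -order_dvdn oy p2.
  have -> : (2 + m * 2 = 2 * m.+1)%N by clear; lia.
  by rewrite -(prednK a_gt0) expnS dvdn_pmul2l.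
(* The square of [y ^+ i * u] is [y ^+ (i * m.+1)], of order at most 2. *)
have ord_N w : w \in N -> w ^+ 4 != 1 -> w \in <[y]>.
  rewrite -defN => /mulsgP[g b /cycleP[i ->{g}] Ab ->{w}].
  case: (A_u b Ab) => -> //; first by rewrite mulg1 mem_cycle.
  case/negP; have uV : u^-1 = u by apply/eqP; rewrite eq_invg_mul uu.
  have -> : (y ^+ i * u) ^+ 4 = ((y ^+ i * u) * (y ^+ i * u)) ^+ 2.
    by rewrite (expgM _ 2 2).
  have -> : y ^+ i * u * (y ^+ i * u) = y ^+ (i * m.+1).
    by rewrite -mulgA -{1}uV -conjgE conjXg yu -expgM -expgD mulnS (mulnC m).
  rewrite -expgM -order_dvdn oy p2 -(prednK a_gt0) expnSr -mulnA.
  by apply/dvdn_mull/dvdn_mul.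
have y4 : y ^+ 4 != 1.
  rewrite -order_dvdn oy p2 -[4%N]/(2 ^ 2)%N dvdn_Pexp2l // -ltnNge.
  exact: a_ge3.
(* If [w] normalises [N], then [y ^ w] lies in [N] and has nontrivial fourth power, so it stays in
   [<[y]>]. Hence [N] is its own normaliser in [P], which forces [N = P]. *)
have NP : N = P :> {set gT}.
  apply/eqP; rewrite eqEproper subsetIl; apply/negP=> prNP.
  have := nilpotent_proper_norm nilP (prNP : [group of N] \proper P).
  rewrite properE => /andP[_ /negP[]]; apply/subsetP=> w /setIP[Pw nNw].
  rewrite inE Pw; apply/normP/eqP; rewrite eqEcard cardJg leqnn andbT.
  rewrite -cycleJ cycle_subG; apply: ord_N.
    by rewrite memJ_norm // (subsetP sGN) ?cycle_id.
  by rewrite -conjXg conjg_eq1.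
have [w Hw Nyw] : exists2 w, w \in H & w \notin <[y]>.
  apply/subsetPn; apply: contra ncH => sHy; exact: cyclicS sHy (cycle_cyclic y).
have oA : #|A| = 2.
  have -> : A = [set 1; u] :> {set _}.
    apply/eqP; rewrite eqEsubset subUset !sub1set group1 Au !andbT.
    by apply/subsetP=> b /A_u; rewrite !inE => -[->|->]; rewrite eqxx ?orbT.
  by rewrite cards2 eq_sym ntu.
have iHP : #|P : H| = 2.
  have le2 : #|P : H| <= 2.
    rewrite -(leq_pmul2l (cardG_gt0 H)) Lagrange // oH -NP -defN -oA.
    rewrite -[#[y]]/#|<[y]>| mul_cardG leq_pmulr //.
  have : 1 < #|P : H|.
    rewrite indexg_gt1; apply/negP=> sPH; move: prGP.
    by rewrite properEcard -[#|<[y]>|]oH ltnNge subset_leq_card // andbF.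
  by move: le2; clear; lia.
have nHP := index2_normal sHP iHP.
have y2H : y ^+ 2 \in H.
  have yPm : y \in P by rewrite (subsetP syP) ?cycle_id.
  have nHy := subsetP (normal_norm nHP) y yPm.
  apply: coset_idr; first by rewrite groupX.
  rewrite morphX // -iHP -card_quotient ?normal_norm //.
  by rewrite expg_cardG // mem_quotient.
(* An element of the abelian group [H] outside [<[y]>] would both centralise and invert [y ^+ 2],
   contradicting [y ^+ 4 != 1]. *)
have cwy2 : (y ^+ 2) ^ w = y ^+ 2.
  by rewrite conjgE (centsP abH _ y2H _ Hw) mulKg.
case/negP: y4; move: (subsetP sHP _ Hw); rewrite -NP -defN.
case/mulsgP=> g b /cycleP[i ->{g}] Ab Dw; case: (A_u b Ab) => Db.
  by case/negP: Nyw; rewrite Dw Db mulg1 mem_cycle.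
move/eqP: cwy2; rewrite Dw Db conjgM.
rewrite [_ ^ (y ^+ i)]conjgE (commuteX2 2 i (commute_refl y)) mulKg y2u.
by rewrite eq_invg_mul -expgD.
Qed.

End CorefreeDoubleCoset.

Lemma mem_gcore (gT : finGroupType) (P S : {group gT}) (x : gT) :
  (forall g, g \in P -> x ^ g \in S) -> x \in gcore S P.
Proof.
by move=> xS; apply/bigcapP=> g Pg; rewrite mem_conjg xS ?groupV.
Qed.

(** [X] centralises its own elements, so a conjugate under [P = X * S] of an element of [X :&: S] is
    already a conjugate under [S]. *)
Lemma abelian_factor_sub_gcore (gT : finGroupType) (P S X : {group gT}) :
  abelian X -> X * S = P -> X :&: S \subset gcore S P.
Proof.
move=> abX defP; apply/subsetP=> x /setIP[Xx Sx]; apply: mem_gcore => g.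
rewrite -defP => /mulsgP[b s Xb Ss ->].
by rewrite conjgM [x ^ b]conjgE (centsP abX x Xx b Xb) mulKg groupJ.
Qed.

(** Reduction to the faithful case modulo the core of [S] in [P]. The core contains the
    intersections of [S] with [H] and with [<[y]>], so both become complements of the image of
    [S]. *)
Lemma noncyclic_factor_dcoset (gT : finGroupType) (p : nat)
    (P S H : {group gT}) (y k : gT) :
    p.-group P -> <[y]> * S = P -> H * S = P -> abelian H ->
    ~~ cyclic (H / (H :&: S)) -> k \in <[y]> -> k ^+ p \in S ->
  dcoset_rel S y (y * k).
Proof.
move=> pP yP HP abH ncH ky kpS; pose C := gcore_group S P.
have sSP : S \subset P by rewrite -HP mulG_subr.
have sHP : H \subset P by rewrite -HP mulG_subl.
have syP : <[y]> \subset P by rewrite -yP mulG_subl.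
have nCP : P \subset 'N(C) := normal_norm (gcore_normal sSP).
have sCS : C \subset S := gcore_sub S P.
have yP1 : y \in P by rewrite -cycle_subG.
have nCy : y \in 'N(C) := subsetP nCP y yP1.
have nCk : k \in 'N(C) := subsetP nCP k (subsetP syP k ky).
have sHC := abelian_factor_sub_gcore abH HP.
have syC := abelian_factor_sub_gcore (cycle_abelian y) yP.
have ky' : coset C k \in <[coset C y]>.
  by rewrite -quotient_cycle // mem_quotient.
have kp' : coset C k ^+ p = 1.
  rewrite -morphX //; apply: coset_id; rewrite (subsetP syC) // inE kpS andbT.
  by rewrite groupX.
have defPb : <[coset C y]> * (S / C) = P / C.
  by rewrite -quotient_cycle // -quotientMl ?yP // (subset_trans syP).
have defPb' : (H / C) * (S / C) = P / C.
  by rewrite -quotientMl ?HP // (subset_trans sHP).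
have tiH : (H / C) :&: (S / C) = 1.
  by rewrite -quotientIG //; apply: quotientS1.
have tiy : <[coset C y]> :&: (S / C) = 1.
  by rewrite -quotient_cycle // -quotientIG //; apply: quotientS1.
have [|||s' [t' []]] := @corefree_dcoset _ p (P / C) (S / C) (H / C)
    (coset C y) (coset C k) (quotient_pgroup C pP) defPb (quotientS C sHP) _
    (quotient_abelian C abH) _ _ ky' kp'.
- apply/eqP; rewrite -(eqn_pmul2r (cardG_gt0 (S / C))) -TI_cardMg //.
  by rewrite defPb' -defPb TI_cardMg.
- apply: contra ncH => cyH; have -> : H :&: S = C :&: H.
    by apply/eqP; rewrite eqEsubset [C :&: H]setIC subsetI subsetIl sHC setIS.
  by rewrite (isog_cyclic (second_isog (subset_trans sHP nCP))).
(* If the image of [s] commutes with that of [y], its conjugates under [P / C] are conjugates under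
   [S / C]; so every conjugate of [s] lies in [S], and [s] lies in the core. *)
- apply/trivgP/subsetP=> xb /setIP[/morphimP[s nCs Ss ->] /cent1P cys].
  rewrite inE; apply/eqP/coset_id/mem_gcore => g Pg.
  have nCg := subsetP nCP g Pg.
  have: coset C (s ^ g) \in S / C.
    move: (mem_quotient C Pg); rewrite -{1}defPb morphJ //=.
    case/mulsgP=> b t /cycleP[i ->] St ->; rewrite conjgM groupJ //.
    by rewrite conjgE (commuteX i cys) mulKg mem_quotient.
  case/morphimP=> t nCt St /eqP; rewrite eq_sym => /eqP eqst.
  have: t^-1 * s ^ g \in C.
    apply: coset_idr; first by rewrite groupM ?groupV ?groupJ.
    by rewrite morphM ?groupV ?groupJ // morphV // eqst mulVg.
  by move/(subsetP sCS); rewrite groupMl ?groupV.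
case/morphimP=> s nCs Ss ->; case/morphimP=> t nCt St ->; rewrite -!morphM ?groupM //.
(* The lifted equation holds up to an element of [C], which the right-hand factor absorbs because
   [C] lies in [S]. *)
move=> eqyk; exists s, (t * ((s * y * t)^-1 * (y * k))); split=> //.
  rewrite groupM // (subsetP sCS) //; apply: coset_idr.
    by rewrite groupM ?groupV ?groupM.
  by rewrite morphM ?groupV ?groupM // morphV ?groupM // eqyk mulVg.
by rewrite !mulgA mulgV mul1g.
Qed.

(** * Cyclic sections of abelian groups and chains of p-subgroups *)

Lemma abelian_expg_index (gT : finGroupType) (A M : {group gT}) (k : gT) :
  abelian A -> M \subset A -> k \in A -> k ^+ #|A : M| \in M.
Proof.
move=> abA sMA Ak; have nMA := sub_abelian_norm abA sMA.
have nMk := subsetP nMA k Ak.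
apply: coset_idr; first by rewrite groupX.
by rewrite morphX // -card_quotient // expg_cardG // mem_quotient.
Qed.

Lemma cyclic_quotientP (gT : finGroupType) (A B : {group gT}) :
    abelian A -> B \subset A ->
  reflect (exists2 h, h \in A & B * <[h]> = A) (cyclic (A / B)).
Proof.
move=> abA sBA; have nBA := sub_abelian_norm abA sBA.
apply: (iffP idP) => [/cyclicP[hb defAB] | [h Ah <-]].
  have: hb \in A / B by rewrite defAB cycle_id.
  case/morphimP=> h nBh Ah Dhb; exists h => //.
  have shA : <[h]> \subset A by rewrite cycle_subG.
  apply/eqP; rewrite eqEsubset mul_subG //= -quotientSK //.
  by rewrite defAB Dhb quotient_cycle.
by rewrite quotientMidl quotient_cyclic ?cycle_cyclic.
Qed.

Lemma cyclic_quotientS (gT : finGroupType) (A B A1 B1 : {group gT}) :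
    abelian A -> B \subset B1 -> B1 \subset A1 -> A1 \subset A ->
  cyclic (A / B) -> cyclic (A1 / B1).
Proof.
move=> abA sBB1 sB1A1 sA1A.
have sB1A := subset_trans sB1A1 sA1A.
case/(cyclic_quotientP abA (subset_trans sBB1 sB1A)) => h Ah defA.
apply: cyclicS (quotientS _ sA1A) _; apply/cyclic_quotientP=> //; exists h => //.
apply/eqP; rewrite eqEsubset mul_subG ?cycle_subG //=.
by rewrite -{1}defA mulSg.
Qed.

(** If [k] generates [A] modulo [L], then [k ^+ p] lies in [M] but not in [L], since [A / L] has
    order [p * p]. As [M / B] is a cyclic p-group, [k ^+ p] then generates [M] modulo [B], so [k]
    generates [A] modulo [B]. *)
Lemma cyclic_quotient_glue (gT : finGroupType) (p : nat)
    (A M L B : {group gT}) :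
    p.-group A -> prime p -> abelian A ->
    B \subset L -> L \subset M -> M \subset A ->
    #|M : L| = p -> #|A : M| = p -> cyclic (M / B) -> cyclic (A / L) ->
  cyclic (A / B).
Proof.
move=> pA p_pr abA sBL sLM sMA iML iAM.
have sBM := subset_trans sBL sLM; have sBA := subset_trans sBM sMA.
have sLA := subset_trans sLM sMA; have abM := abelianS sMA abA.
case/(cyclic_quotientP abM sBM) => h Mh defM.
case/(cyclic_quotientP abA sLA) => k Ak defA.
have kpM : k ^+ p \in M by rewrite -iAM abelian_expg_index.
have hpL : h ^+ p \in L by rewrite -iML abelian_expg_index.
have kpL : k ^+ p \notin L.
  apply: contraL (prime_gt1 p_pr) => kpL.
  rewrite -leqNgt -(leq_pmul2l (prime_gt0 p_pr)) muln1.
  have <- : #|A : L| = (p * p)%N by rewrite -(Lagrange_index sMA sLM) iAM iML.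
  have nLk : <[k]> \subset 'N(L).
    by rewrite cycle_subG (subsetP (sub_abelian_norm abA sLA)).
  have -> : #|A : L| = #[coset L k].
    rewrite -card_quotient; last exact: sub_abelian_norm abA sLA.
    by rewrite -defA quotientMidl quotient_cycle // -cycle_subG.
  apply: dvdn_leq (prime_gt0 p_pr) _; rewrite order_dvdn -morphX -?cycle_subG //.
  exact/eqP/coset_id.
pose X := [group of B <*> <[k]>].
have defX : B * <[k]> = X.
  apply/esym/comm_joingE/centC/(sub_abelian_cent2 abA) => //.
  by rewrite cycle_subG.
have sBX : B \subset X := joing_subl _ _.
have kX : k \in X by rewrite mem_gen // inE cycle_id orbT.
have hX : h \in X.
  move: kpM; rewrite -{1}defM => /mulsgP[b hi Bb /cycleP[i ->{hi}] Dkp].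
  have co_pi : coprime p i.
    rewrite prime_coprime //; apply: contra kpL => /dvdnP[j Dj].
    by rewrite Dkp groupM ?(subsetP sBL b Bb) // Dj mulnC expgM groupX.
  have: h ^+ i \in X.
    by rewrite -(groupMl _ (subsetP sBX b Bb)) -Dkp groupX.
  rewrite -!cycle_subG; apply: subset_trans.
  suff /eqP-> : generator <[h]> (h ^+ i) by [].
  rewrite generator_coprime; have ph : p.-elt h := mem_p_elt pA (subsetP sMA h Mh).
  by apply: pnat_coprime ph _; rewrite p'natE // -prime_coprime.
have sMX : M \subset X by rewrite -defM mul_subG ?cycle_subG.
apply/cyclic_quotientP=> //; exists k => //; rewrite defX; apply/eqP.
rewrite eqEsubset -{1}defX mul_subG ?cycle_subG //=.
by rewrite -{1}defA mul_subG ?cycle_subG // (subset_trans sLM).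
Qed.

Lemma cyclic_pgroup_generator (gT : finGroupType) (p : nat)
    (X X1 : {group gT}) (y : gT) :
    p.-group X -> prime p -> cyclic X -> X1 \subset X -> #|X : X1| = p ->
  y \in X -> y \notin X1 -> <[y]> = X.
Proof.
move=> pX p_pr cycX sX1X iX; case/cyclicP: (cycX) => x defX.
have Xx : x \in X by rewrite defX cycle_id.
rewrite {1}defX => /cycleP[i ->] X1'y.
have xpX1 : x ^+ p \in X1 by rewrite -iX abelian_expg_index ?cyclic_abelian.
have co_pi : coprime p i.
  rewrite prime_coprime //; apply: contra X1'y => /dvdnP[j ->].
  by rewrite mulnC expgM groupX.
apply/esym/eqP; rewrite defX -/(generator _ _) generator_coprime.
by apply: pnat_coprime (mem_p_elt pX Xx) _; rewrite p'natE // -prime_coprime.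
Qed.

Lemma pgroup_index_chain (gT : finGroupType) (p : nat) (P S : {group gT}) :
    p.-group P -> S \subset P ->
  exists a (Q : nat -> {group gT}), [/\ Q 0 = S, Q a = P &
    forall i, i < a -> Q i \subset Q i.+1 /\ #|Q i.+1 : Q i| = p].
Proof.
have [n] := ubnP #|P|; elim: n P => // n IHn P leP pP sSP.
case: (maximal_exists sSP) => [defS|[M maxM sSM]].
  by exists 0, (fun=> S); split=> //; apply: group_inj.
have sMP := maxgroupp maxM.
have sMP' := proper_sub sMP.
have [|a [Q [Q0 Qa QS]]] := IHn M _ (pgroupS sMP' pP) sSM.
  by rewrite -ltnS (leq_trans _ leP) // ltnS proper_card.
exists a.+1, (fun i => if i <= a then Q i else P); split=> /= [||i].
- by [].
- by rewrite ltnn.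
rewrite [i < _]ltnS => le_ia; case: (eqVneq i a) (le_ia) => [->|ne_ia] _; last first.
  have lt_ia : i < a by rewrite ltn_neqAle ne_ia.
  by rewrite le_ia lt_ia; apply: QS.
by rewrite leqnn ltnn Qa sMP' (p_maximal_index pP).

Qed.

(** * Wreath chains *)

(* Parallel chains of subgroups of G and H with cyclic factors of equal orders;
   the last premise makes every orbital with respect to S a union of cosets of A
   on A' :\: A, i.e. invariant under the multiwreath product of the chain. *)
Inductive wreath_chain (gT : finGroupType) (S : {set gT}) :
    {group gT} -> {group gT} -> Prop :=
| WreathChainBase (A B : {group gT}) :
    A :=: 1 -> B :=: 1 -> wreath_chain S A B
| WreathChainStep (A B A' B' : {group gT}) :
    wreath_chain S A B -> A \subset A' -> B \subset B' ->
    #|A' : A| = #|B' : B| ->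
    abelian A' -> abelian B' -> cyclic (A' / A) -> cyclic (B' / B) ->
    (forall y k, y \in A' -> y \notin A -> k \in A -> dcoset_rel S y (y * k)) ->
  wreath_chain S A' B'.

Section WreathChain.

Variables (gT : finGroupType) (p : nat) (P S G H : {group gT}).
Hypotheses (pr_p : prime p) (pP : p.-group P) (cycG : cyclic G) (abH : abelian H).
Hypotheses (defP : G * S = P) (defP' : H * S = P).
Hypotheses (tiGS : G :&: S = 1) (tiHS : H :&: S = 1).
Variables (a : nat) (Q : nat -> {group gT}).
Hypotheses (Q0 : Q 0 = S) (Qa : Q a = P).
Hypothesis QS : forall i, i < a -> Q i \subset Q i.+1 /\ #|Q i.+1 : Q i| = p.

Lemma chain_subset i j : i <= j -> j <= a -> Q i \subset Q j.
Proof.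
elim: j => [|j IHj]; first by rewrite leqn0 => /eqP->.
rewrite leq_eqVlt => /predU1P[->//|le_ij] lt_ja.
exact: subset_trans (IHj le_ij (ltnW lt_ja)) (QS lt_ja).1.
Qed.

Lemma chain_sub_top i : i <= a -> Q i \subset P.
Proof. by move=> le_ia; rewrite -Qa chain_subset. Qed.

Lemma chain_sup_bottom i : i <= a -> S \subset Q i.
Proof. by move=> le_ia; rewrite -Q0 chain_subset. Qed.

Lemma chain_factor (X : {group gT}) i j :
  X * S = P -> i <= j -> j <= a -> (X :&: Q j) * Q i = Q j.
Proof.
move=> defPX le_ij le_ja; have le_ia := leq_trans le_ij le_ja.
rewrite setIC group_modr ?chain_subset //; apply/setIidPl.
apply: subset_trans (chain_sub_top le_ja) _; rewrite -defPX.
exact: mulgS (chain_sup_bottom le_ia).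
Qed.

Lemma chain_index (X : {group gT}) i :
  X * S = P -> X :&: S = 1 -> i < a -> #|X :&: Q i.+1 : X :&: Q i| = p.
Proof.
move=> defPX tiXS lt_ia; have [sQ iQ] := QS lt_ia.
have cardX j : j <= a -> (#|X :&: Q j| * #|S| = #|Q j|)%N.
  move=> le_ja; rewrite -{2}(chain_factor defPX (leq0n j) le_ja) Q0 TI_cardMg //.
  by apply/trivgP; rewrite -tiXS setSI ?subsetIl.
apply/eqP; rewrite -(eqn_pmul2l (cardG_gt0 (X :&: Q i))) Lagrange ?setIS //.
rewrite -(eqn_pmul2r (cardG_gt0 S)) cardX // mulnAC cardX ?(ltnW lt_ia) //.
by rewrite -iQ Lagrange.
Qed.

Let abG := cyclic_abelian cycG.

(** Induction on the level of [k]: the key fact, applied in [Q v] with [Q j] as stabiliser, gives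
    [s1 * y * t1] with [s1] and [t1] in [Q j]. Splitting these along [Q j = (G :&: Q j) * S] and
    commuting inside [G] leaves a multiplier of lower level. *)
Lemma chain_dcoset s v y k :
    0 < s -> s < v -> v <= a -> ~~ cyclic ((H :&: Q s.+1) / (H :&: Q s.-1)) ->
    y \in G :&: Q v -> y \notin Q v.-1 -> k \in G :&: Q s ->
  dcoset_rel S y (y * k).
Proof.
move=> s_gt0 lt_sv le_va ncH Gvy nQy; have v_gt0 := leq_ltn_trans (leq0n s) lt_sv.
have lt_v1a : v.-1 < a by rewrite prednK.
have le_sa : s <= a := leq_trans (ltnW lt_sv) le_va.
have Gy : y \in G by case/setIP: Gvy.
have defGv : <[y]> = G :&: Q v.
  apply: (cyclic_pgroup_generator (X1 := [group of G :&: Q v.-1]) _ pr_p) => //.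
  - by rewrite (pgroupS _ pP) // subIset // chain_sub_top ?orbT.
  - exact: cyclicS (subsetIl _ _) cycG.
  - by rewrite setIS // chain_subset // leq_pred.
  - by rewrite -[in LHS](prednK v_gt0) chain_index.
  by rewrite inE Gy.
have genk j : j <= s -> forall k', k' \in G :&: Q j -> dcoset_rel S y (y * k').
  elim: j => [|j IHj] lt_js k' /setIP[Gk' Qk'].
    exists 1, k'; rewrite group1 mul1g; split=> //; by rewrite -Q0.
  have le_jv : j <= v := ltnW (leq_trans lt_js (ltnW lt_sv)).
  have le_ja := leq_trans le_jv le_va.
  have [|||||||s1 [t1 [Qs1 Qt1 ->]]] :=
    @noncyclic_factor_dcoset _ p (Q v) (Q j) (H :&: Q v) y k'.
  - exact: pgroupS (chain_sub_top le_va) pP.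
  - by rewrite defGv chain_factor.
  - exact: chain_factor.
  - by rewrite (abelianS _ abH) ?subsetIl.
  (* As [j < s < v], the noncyclic factor between levels [s.-1] and [s.+1] is a section of this
     one. *)
  - apply: contra ncH; rewrite -setIA (setIidPr (chain_subset le_jv le_va)).
    apply: cyclic_quotientS.
    + by rewrite (abelianS _ abH) ?subsetIl.
    + by rewrite setIS // chain_subset ?(leq_trans (leq_pred s)) // -ltnS prednK.
    + by rewrite setIS // chain_subset ?(leq_trans lt_sv) // (leq_trans (leq_pred s)).
    + by rewrite setIS // chain_subset.
  - rewrite defGv inE Gk' (subsetP (chain_subset _ le_va) _ Qk') //.
    exact: leq_trans lt_js (ltnW lt_sv).
  - have lt_ja : j < a := leq_trans lt_js le_sa.
    have: k' ^+ p \in G :&: Q j.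
      rewrite -(chain_index defP tiGS lt_ja) abelian_expg_index //.
      * by rewrite (abelianS _ abG) ?subsetIl.
      * by rewrite setIS // (QS lt_ja).1.
      by rewrite inE Gk'.
    by case/setIP.
  have SGj t : t \in Q j ->
      exists2 g, g \in G :&: Q j & exists2 b, b \in S & t = g * b.
    rewrite -{1}(chain_factor defP (leq0n j) le_ja) Q0.
    by case/mulsgP=> g b Gg Sb ->; exists g => //; exists b.
  have [g2 Gg2 [b2 Sb2 ->]] := SGj t1 Qt1.
  have [g1 Gg1 [b1 Sb1 Ds1]] := SGj s1^-1 (groupVr Qs1).
  have [s2 [t2 [Ss2 St2 Dy]]] := IHj (ltnW lt_js) _ (groupM (groupVr Gg1) Gg2).
  exists (b1^-1 * s2), (t2 * b2); split; rewrite ?groupM ?groupV //.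
  rewrite -[s1]invgK Ds1 invMg !mulgA -(mulgA b1^-1 s2) -(mulgA _ (s2 * y)) -Dy.
  have Cy : commute g1^-1 y.
    by apply: (centsP abG) => //; rewrite groupV; case/setIP: Gg1.
  by rewrite -!mulgA (mulgA g1^-1) Cy !mulgA.
by apply: genk.
Qed.

Lemma chain_extend s u :
    s < u -> u <= a -> wreath_chain S (G :&: Q s) (H :&: Q s) ->
    cyclic ((H :&: Q u) / (H :&: Q s)) ->
    (s == 0) || ~~ cyclic ((H :&: Q s.+1) / (H :&: Q s.-1)) ->
  wreath_chain S (G :&: Q u) (H :&: Q u).
Proof.
move=> lt_su le_ua chain_s cycH cut_s; have le_su := ltnW lt_su.
have index_su (X : {group gT}) : X * S = P -> X :&: S = 1 ->
    #|X :&: Q u : X :&: Q s| = (p ^ (u - s))%N.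
  move=> defPX tiXS; elim: u le_su le_ua {lt_su cycH} => [|v IHv].
    by rewrite leqn0 => /eqP-> _; rewrite indexgg.
  rewrite leq_eqVlt => /predU1P[->|lt_sv] lt_va; first by rewrite subnn indexgg.
  have le_va := ltnW lt_va.
  rewrite -(@Lagrange_index _ _ (X :&: Q v)) ?setIS ?chain_subset // chain_index // IHv //.
  by rewrite subSn // expnS.
apply: (WreathChainStep chain_s) => //.
- by rewrite setIS ?chain_subset.
- by rewrite setIS ?chain_subset.
- by rewrite !index_su.
- exact: abelianS (subsetIl _ _) abG.
- exact: abelianS (subsetIl _ _) abH.
- exact/quotient_cyclic/(cyclicS (subsetIl _ _)).
move=> y k Guy nGy Gsk; case: (posnP s) cut_s => [s0 _ | s_gt0 ncH].
  have k1 : k = 1 by apply/set1P; rewrite -[[set 1]]tiGS -Q0 -s0.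
  by exists 1, 1; rewrite !group1 k1 mul1g.
have [Gy Quy] := setIP Guy; have exQ : exists v, y \in Q v by exists u.
(* The lowest level [v] containing [y] leaves [y] outside [Q v.-1]. *)
case: (ex_minnP exQ) => v Qvy min_v; have le_vu := min_v u Quy.
have lt_sv : s < v.
  rewrite ltnNge; apply: contra nGy => le_vs; rewrite inE Gy.
  by rewrite (subsetP (chain_subset le_vs (leq_trans le_su le_ua))).
apply: (chain_dcoset s_gt0 lt_sv (leq_trans le_vu le_ua) ncH) => //.
  by rewrite inE Gy.
apply/negP=> /min_v; rewrite leqNgt prednK ?leqnn //.
exact: leq_ltn_trans lt_sv.
Qed.

(** Greedy cutting, with [s] the last cut below [u]. Either the cyclic factor above [s] grows to
    level [u.+1], or [u] is a new cut: by [cyclic_quotient_glue] the loss of cyclicity is already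
    visible between levels [u.-1] and [u.+1]. *)
Lemma chain_cut u : 0 < u -> u <= a -> exists s, [/\ s < u,
    wreath_chain S (G :&: Q s) (H :&: Q s),
    cyclic ((H :&: Q u) / (H :&: Q s)) &
    (s == 0) || ~~ cyclic ((H :&: Q s.+1) / (H :&: Q s.-1))].
Proof.
elim: u => [//|u IHu] _ lt_ua; have [u0|u_gt0] := posnP u.
  exists 0; split=> //; first by apply: WreathChainBase; rewrite Q0.
  rewrite u0 in lt_ua *; apply: prime_cyclic.
  rewrite card_quotient ?chain_index // sub_abelian_norm ?(abelianS _ abH) ?subsetIl //.
  by rewrite setIS ?chain_subset.
have [s [lt_su chain_s cycH cut_s]] := IHu u_gt0 (ltnW lt_ua).
have [cycH'|ncH] := boolP (cyclic ((H :&: Q u.+1) / (H :&: Q s))).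
  by exists s; split=> //; apply: ltnW.
exists u; split=> //.
- exact: chain_extend lt_su (ltnW lt_ua) chain_s cycH cut_s.
- apply: prime_cyclic.
  rewrite card_quotient ?chain_index // sub_abelian_norm ?(abelianS _ abH) ?subsetIl //.
  by rewrite setIS ?chain_subset.
apply/orP; right; apply: contra ncH => cycH'.
have sHQ i j : i <= j -> j <= a -> H :&: Q i \subset H :&: Q j.
  by move=> le_ij le_ja; rewrite setIS ?chain_subset.
have lt_u1a : u.-1 < a by rewrite prednK // ltnW.
apply: (@cyclic_quotient_glue _ p [group of H :&: Q u.+1] [group of H :&: Q u]
  [group of H :&: Q u.-1] [group of H :&: Q s]) => //=.
- by rewrite (pgroupS _ pP) // subIset // chain_sub_top ?orbT.
- exact: abelianS (subsetIl _ _) abH.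
- by rewrite sHQ // ?(ltnW lt_u1a) // -ltnS prednK.
- by rewrite sHQ ?leq_pred // ltnW.
- by rewrite sHQ.
- by rewrite -{1}(prednK u_gt0) chain_index.
by rewrite chain_index.
Qed.

End WreathChain.

Theorem pgroup_wreath_chain (gT : finGroupType) (p : nat)
    (P S G H : {group gT}) :
    prime p -> p.-group P -> cyclic G -> abelian H ->
    G * S = P -> H * S = P -> G :&: S = 1 -> H :&: S = 1 ->
  wreath_chain S G H.
Proof.
move=> pr_p pP cycG abH defP defP' tiG tiH.
have sSP : S \subset P by rewrite -defP mulG_subr.
have sGP : G \subset P by rewrite -defP mulG_subl.
have sHP : H \subset P by rewrite -defP' mulG_subl.
have [a [Q [Q0 Qa QS]]] := pgroup_index_chain pP sSP.
have defG : G = (G :&: Q a)%G.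
  by apply: group_inj; rewrite /= Qa; apply/esym/setIidPl.
have defH : H = (H :&: Q a)%G.
  by apply: group_inj; rewrite /= Qa; apply/esym/setIidPl.
have [a0|a_gt0] := posnP a.
  by apply: WreathChainBase; [rewrite defG | rewrite defH]; rewrite /= a0 Q0.
have [s [lt_sa chain_s cycH cut_s]] :=
  chain_cut pr_p pP cycG abH defP defP' tiG tiH Q0 Qa QS a_gt0 (leqnn a).
rewrite defG defH.
exact: (chain_extend pr_p pP cycG abH defP defP' tiG tiH Q0 Qa QS lt_sa).
Qed.

(** * Lexicographic products over directed cycles *)

Section Rotation.

Variable n : nat.

Definition rotation : {perm 'I_n.+2} := perm (@ordS_inj n.+2).

Lemma rotationX (k : nat) (x : 'I_n.+2) :
  (rotation ^+ k) x = (x + k) %% n.+2 :> nat.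
Proof.
elim: k => [|k IHk]; first by rewrite perm1 addn0 modn_small.
by rewrite expgSr permM permE /= IHk -addn1 modnDml addn1 addnS.
Qed.

(** Commuting with the successor determines a permutation by its value at [ord0]. *)
Lemma rotation_cent (s : {perm 'I_n.+2}) :
  (forall x, s (ordS x) = ordS (s x)) -> s \in <[rotation]>.
Proof.
move=> s_ordS; apply/cycleP; exists (s ord0); apply/permP=> x; apply: val_inj.
have sX k : s ((rotation ^+ k) ord0) = (rotation ^+ k) (s ord0).
  by elim: k => [|k IHk]; rewrite ?perm1 // expgSr !permM !permE s_ordS IHk.
have -> : x = (rotation ^+ x) ord0.
  by apply: val_inj; rewrite /= rotationX add0n modn_small.
by rewrite sX /= !rotationX add0n modnDml addnC.
Qed.

Lemma rotation_regular : regular_permgroup <[rotation]>.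
Proof.
split=> [|x].
  apply/imsetP; exists ord0 => //; apply/eqP; rewrite eq_sym eqEsubset subsetT.
  apply/subsetP=> x _; apply/orbitP; exists (rotation ^+ x); first exact: mem_cycle.
  by apply: val_inj; rewrite /= apermE rotationX add0n modn_small.
apply/trivgP/subsetP=> s /setIP[/cycleP[k ->] /astab1P/=]; rewrite apermE.
move/(congr1 val)/eqP; rewrite /= rotationX -{2}(modn_small (ltn_ord x)).
rewrite -{2}[val x]addn0 eqn_modDl mod0n => /eqP k0; rewrite inE; apply/eqP/permP=> y.
by apply: val_inj; rewrite /= rotationX perm1 -modnDmr k0 addn0 modn_small.
Qed.

End Rotation.

(** The index [n.+2] guarantees at least two blocks, so that [ordS] has no fixed point; for [n = 0]
    the cycle is a pair of opposite arcs. *)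
Definition cycle_lex (n : nat) (D : digraph) : digraph :=
  @Digraph ('I_n.+2 * vertex D)%type
    (fun u v => if u.1 == v.1 then arc u.2 v.2 else v.1 == ordS u.1).

Lemma ordS_neq (n : nat) (x : 'I_n.+2) : (x == ordS x) = false.
Proof.
apply/negP=> /eqP/(congr1 val)/=; have := ltn_ord x.
rewrite leq_eqVlt => /predU1P[eqx|lt_x]; first by rewrite eqx modnn; lia.
by rewrite modn_small //; lia.
Qed.

Section CycleLexAut.

Variables (n : nat) (D : digraph) (y0 : vertex D).
Hypothesis small_outdeg :
  forall y : vertex D, (#|[pred z | arc y z]|).*2 < #|vertex D|.

Let L := cycle_lex n D.

Definition common_out (E : digraph) (u v : vertex E) : {set vertex E} :=
  [set z | arc u z && arc v z].

Lemma card_common_out_aut (E : digraph) (s : {perm vertex E}) (u v : vertex E) :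
  s \in digraph_aut E -> #|common_out (s u) (s v)| = #|common_out u v|.
Proof.
move/digraph_autP=> sE; rewrite -[RHS](card_imset _ (@perm_inj _ s)); apply: eq_card => z.
apply/idP/imsetP=> [|[t]]; last by rewrite !inE => ht ->; rewrite !sE.
move=> hz; exists (s^-1 z); last by rewrite permKV.
by move: hz; rewrite !inE -{1 2}(permKV s z) !sE.
Qed.

(* Two vertices have at least #|vertex D| common out-neighbours exactly when
   they lie in the same copy of D; this is how automorphisms see the blocks. *)
Lemma common_out_same_block (u v : vertex L) :
  (#|vertex D| <= #|common_out u v|) = (u.1 == v.1).
Proof.
apply/idP/idP=> [|/eqP uv].
  apply: contraTT => neq_uv; rewrite -ltnNge.
  pose U (x : vertex L) : {set vertex L} := (fun t => (x.1, t)) @: [pred t | arc x.2 t].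
  have cU x : #|U x| = #|[pred t | arc x.2 t]|.
    by rewrite card_imset // => t1 t2 [].
  (* Outside its own block a vertex reaches only the next block, and distinct blocks have distinct
     successors; so a common out-neighbour is an inner neighbour of [u] or of [v]. *)
  have sub : common_out u v \subset U u :|: U v.
    apply/subsetP=> -[z1 z2]; rewrite !inE /= => /andP[].
    case: eqP => [<-|_].
      by move=> uz _; rewrite imset_f.
    move=> /eqP->; case: eqP => [eqv|_].
      by move=> vz; rewrite -eqv imset_f ?orbT.
    by rewrite (inj_eq (@ordS_inj _)) (negPf neq_uv).
  apply: leq_ltn_trans (subset_leq_card sub) _.
  apply: leq_ltn_trans (leq_card_setU _ _) _; rewrite !cU.
  have := small_outdeg u.2; have := small_outdeg v.2; lia.
have inj_b : injective (fun t : vertex D => (ordS u.1, t) : vertex L) by move=> t1 t2 [].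
rewrite -(card_codom inj_b) -cardsE; apply: subset_leq_card; apply/subsetP=> z.
rewrite inE => /codomP[t ->]; rewrite !inE /= -uv ordS_neq eqxx //.
Qed.

(** Automorphisms permute the blocks by [common_out_same_block], and the arcs between blocks force
    the induced permutation to commute with [ordS]. *)
Lemma aut_cycle_lex :
  digraph_aut L = wreath <[rotation n]> (digraph_aut D).
Proof.
apply/setP=> s; apply/idP/idP => [sL | ]; last first.
  rewrite inE => /exists_inP[a /cycleP[k ->]] /existsP[b /andP[/forallP bD /forallP sE]].
  apply/digraph_autP=> u v; rewrite (eqP (sE u)) (eqP (sE v)) /= (inj_eq perm_inj).
  case: eqP => [->|_]; first by have /digraph_autP-> := bD v.1.
  have -> : ordS ((rotation n ^+ k) u.1) = (rotation n ^+ k) (ordS u.1).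
    have rS x : ordS x = rotation n x by rewrite permE.
    by rewrite !rS -!permM -expgS -expgSr.
  by rewrite (inj_eq perm_inj).
have same u v : ((s u).1 == (s v).1) = (u.1 == v.1).
  by rewrite -!common_out_same_block card_common_out_aut.
have /digraph_autP sA := sL.
(* By [same], the block of [s (x, y)] does not depend on [y]; [y0] is a representative. *)
pose af x := (s (x, y0)).1; have af_inj : injective af.
  by move=> x1 x2 /eqP; rewrite same => /eqP.
pose bf x y := (s (x, y)).2.
have sE x y : s (x, y) = (af x, bf x y).
  by rewrite [LHS]surjective_pairing; congr (_, _); apply/eqP; rewrite same.
have bf_inj x : injective (bf x).
  move=> y1 y2 eqb; have /(congr1 snd) // : (x, y1) = (x, y2) :> vertex L.
  by apply: (@perm_inj _ s); rewrite !sE eqb.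
rewrite inE; apply/exists_inP; exists (perm af_inj).
  apply: rotation_cent => x; rewrite !permE; apply/eqP.
  have := sA (x, y0) (ordS x, y0); rewrite !sE /= !ordS_neq eqxx.
  by rewrite (inj_eq af_inj) ordS_neq.
apply/existsP; exists [ffun x => perm (bf_inj x)]; apply/andP; split.
  apply/forallP=> x; apply/digraph_autP=> y1 y2; rewrite ffunE !permE.
  by have := sA (x, y1) (x, y2); rewrite !sE /= !eqxx.
by apply/forallP=> -[x y]; rewrite ffunE /= !permE sE.
Qed.

(** Constancy of the out-degree is passed on so that at the next level the digraph or its loopless
    complement satisfies [small_outdeg]. *)
Lemma outdeg_cycle_lex d : (forall y : vertex D, #|[pred z | arc y z]| = d) ->
  forall u : vertex L, #|[pred v | arc u v]| = (d + #|vertex D|)%N.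
Proof.
move=> outD u.
pose U : {set vertex L} := (fun t => (u.1, t)) @: [pred t | arc u.2 t].
pose W : {set vertex L} := (fun t => (ordS u.1, t)) @: [pred t : vertex D | true].
have -> : #|[pred v | arc u v]| = #|U :|: W|.
  apply: eq_card => -[z1 z2]; rewrite !inE /=; apply/idP/orP.
    case: eqP => [<- uz | _ /eqP->]; [by left; rewrite imset_f | right].
    by rewrite imset_f.
  case=> /imsetP[t]; rewrite ?inE => ht [-> ->]; first by rewrite eqxx.
  by rewrite ordS_neq.
rewrite cardsU disjoint_setI0; last first.
  rewrite -setI_eq0; apply/eqP/setP=> z; rewrite !inE; apply/negP.
  case/andP=> /imsetP[t1 _ ->] /imsetP[t2 _ [/eqP]]; by rewrite ordS_neq.
by rewrite cards0 subn0 !card_imset ?outD // => t1 t2 [].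
Qed.

End CycleLexAut.

Definition loopless_compl (D : digraph) : digraph :=
  @Digraph (vertex D) (fun x y => (x != y) && ~~ arc x y).

Lemma aut_loopless_compl (D : digraph) :
    irreflexive (@arc D) ->
  digraph_aut (loopless_compl D) = digraph_aut D.
Proof.
move=> irrD; apply/setP=> s.
apply/(@digraph_autP (loopless_compl D) s)/(@digraph_autP D s)=> sD x y /=.
  have [-> | neq_xy] := eqVneq x y; first by rewrite !irrD.
  have := sD x y; rewrite /= (inj_eq perm_inj) neq_xy /= => /(congr1 negb).
  by rewrite !negbK.
by rewrite (inj_eq perm_inj) sD.
Qed.

Lemma outdeg_loopless_compl (D : digraph) (x : vertex D) :
    irreflexive (@arc D) ->
  (#|[pred y | arc x y]|
     + #|[pred y | arc (x : vertex (loopless_compl D)) y]|).+1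
    = #|vertex D|.
Proof.
move=> irrD; rewrite -addnS; set c := #|[pred y : vertex (loopless_compl D) | _]|.
have <- : #|predC [pred y : vertex D | arc x y]| = c.+1.
  rewrite (cardD1 x) !inE irrD add1n; congr _.+1; apply: eq_card => y.
  by rewrite !inE /= eq_sym.
exact: cardC.
Qed.

(** A Cayley structure without subtypes: [f] is total but constrained only on [A], so nested
    subgroups of [gT] share one type of labels. *)
Definition left_invariant_labelling (gT : finGroupType) (A : {group gT})
    (D : digraph) (f : gT -> vertex D) : Prop :=
  [/\ {in A &, injective f}, #|vertex D| = #|A| &
      {in A & &, forall a x y, arc (f (a * x)) (f (a * y)) = arc (f x) (f y)}].

Lemma left_invariant_cayley (gT : finGroupType) (A : {group gT}) (D : digraph)
    (f : gT -> vertex D) :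
  left_invariant_labelling A f -> cayley_digraph_on A D.
Proof.
case=> f_inj oD f_inv; exists [set s in A | arc (f 1) (f s)].
  by apply/subsetP=> s; rewrite inE => /andP[].
exists (fun x => f (sgval x)).
  apply: inj_card_bij => [x y /f_inj|]; last by rewrite oD card_sub.
  by move/(_ (subgP x) (subgP y))/val_inj.
move=> x y /=; have [Ax Ay] := (subgP x, subgP y).
apply/idP/exists_inP=> [xy | [s]].
  exists ((sgval x)^-1 * sgval y); last by rewrite mulKVg.
  rewrite inE groupM ?groupV //=.
  by rewrite -(f_inv (sgval x)) ?groupM ?groupV // mulg1 mulKVg.
rewrite inE => /andP[As as1] /eqP->.
by rewrite -{1}[sgval x]mulg1 f_inv.
Qed.

Section LexLabelling.

Variables (gT : finGroupType) (A A' : {group gT}) (h : gT) (n : nat).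
Variables (D : digraph) (f : gT -> vertex D).
Hypotheses (abA' : abelian A') (sAA' : A \subset A') (A'h : h \in A').
Hypotheses (defA' : A * <[h]> = A') (iA : #|A' : A| = n.+2).
Hypothesis f_lab : left_invariant_labelling A f.

Let cA' x y : x \in A' -> y \in A' -> x * y = y * x.
Proof. by move=> Ax Ay; apply: (centsP abA'). Qed.

Lemma expg_mod_index k i : (h ^- k * h ^+ i \in A) = (k == i %[mod n.+2]).
Proof.
have nAA' := sub_abelian_norm abA' sAA'; have nAh := subsetP nAA' h A'h.
have -> : n.+2 = #[coset A h].
  by rewrite -iA -card_quotient // -defA' quotientMidl quotient_cycle.
rewrite -eq_expg_mod_order -!morphX // eq_mulVg1 -morphV ?groupX //.
rewrite -morphM ?groupV ?groupX //; apply/idP/eqP => [/coset_id // | ].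
by apply: coset_idr; rewrite groupM ?groupV ?groupX.
Qed.

(** On [A'] the search succeeds, as [h] generates [A'] modulo [A]; the default [ord0] is a value
    outside [A']. *)
Definition coset_index (x : gT) : 'I_n.+2 :=
  odflt ord0 [pick i : 'I_n.+2 | h ^- i * x \in A].

Lemma coset_index_mod k x :
  x \in A' -> h ^- k * x \in A -> coset_index x = k %% n.+2 :> nat.
Proof.
move=> A'x kx; rewrite /coset_index; case: pickP => [i ix /= | ]; last first.
  move/(_ (inord (k %% n.+2))); rewrite inordK ?ltn_mod //.
  suff -> : h ^- (k %% n.+2) * x \in A by [].
  have -> : h ^- (k %% n.+2) * x = h ^- (k %% n.+2) * h ^+ k * (h ^- k * x).
    by rewrite -mulgA mulKVg.
  by rewrite groupM // expg_mod_index modn_mod.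
have: h ^- i * h ^+ k \in A.
  have -> : h ^- i * h ^+ k = h ^- i * x * (h ^- k * x)^-1.
    by rewrite invMg invgK !mulgA mulgK.
  by rewrite groupM ?groupV.
by rewrite expg_mod_index modn_small // => /eqP.
Qed.

Lemma coset_indexP x : x \in A' -> h ^- (coset_index x) * x \in A.
Proof.
move=> A'x; move: (A'x); rewrite -{1}defA' => /mulsgP[b hk Ab /cycleP[k ->] Dx].
have kx : h ^- k * x \in A.
  rewrite Dx -(cA' (groupX k A'h) (subsetP sAA' b Ab)) mulKg //.
rewrite (coset_index_mod A'x kx).
have -> : h ^- (k %% n.+2) * x = h ^- (k %% n.+2) * h ^+ k * (h ^- k * x).
  by rewrite -mulgA mulKVg.
by rewrite groupM // expg_mod_index modn_mod.
Qed.

Lemma coset_indexM x y : x \in A' -> y \in A' ->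
  coset_index (x * y) = (coset_index x + coset_index y) %% n.+2 :> nat.
Proof.
move=> A'x A'y; apply: coset_index_mod; first exact: groupM.
set i := coset_index x; set j := coset_index y.
have -> : h ^- (i + j) * (x * y) = (h ^- i * x) * (h ^- j * y).
  rewrite -[RHS]mulgA (mulgA x) (cA' A'x (groupVr (groupX j A'h))).
  by rewrite addnC expgD invMg -!mulgA.
by rewrite groupM ?coset_indexP.
Qed.

Lemma coset_index_eq x y : x \in A' -> y \in A' ->
  (coset_index x == coset_index y) = (x^-1 * y \in A).
Proof.
move=> A'x A'y; apply/eqP/idP => [eq_xy | xy].
  have -> : x^-1 * y = (h ^- coset_index x * x)^-1 * (h ^- coset_index y * y).
    by rewrite eq_xy invMg invgK -mulgA mulKVg.
  by rewrite groupM ?groupV ?coset_indexP.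
apply/val_inj/esym; rewrite /= -[RHS](modn_small (ltn_ord _)); apply: coset_index_mod => //.
have -> : h ^- coset_index x * y = h ^- coset_index x * x * (x^-1 * y).
  by rewrite -mulgA mulKVg.
by rewrite groupM ?coset_indexP.
Qed.

Definition lex_label (x : gT) : vertex (cycle_lex n D) :=
  (coset_index x, f (h ^- coset_index x * x)).

(** Left translation by [b] shifts the block indices by that of [b] and maps each block to its image
    by a left translation of [A]. *)
Lemma lex_label_left_invariant : left_invariant_labelling A' lex_label.
Proof.
have [f_inj oD f_inv] := f_lab; split.
- move=> x y A'x A'y [eq_xy /f_inj]; rewrite !coset_indexP // eq_xy.
  by move=> /(_ isT isT)/mulgI.
- by rewrite card_prod card_ord oD -(Lagrange sAA') iA mulnC.
move=> b x y A'b A'x A'y; rewrite [LHS]/= [RHS]/=.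
have -> : (coset_index (b * x) == coset_index (b * y))
    = (coset_index x == coset_index y).
  rewrite (coset_index_eq (groupM A'b A'x) (groupM A'b A'y)) coset_index_eq //.
  by rewrite invMg -mulgA mulKg.
have [eqi | _] := eqVneq (coset_index x) (coset_index y).
  have eqbi : coset_index (b * x) = coset_index (b * y).
    by apply/val_inj; rewrite /= !coset_indexM // eqi.
  (* The translation induced on the block of [x]; it depends only on that block, so it serves for
     [y] as well. *)
  pose c := h ^- coset_index (b * x) * b * h ^+ coset_index x.
  have Dx : h ^- coset_index (b * x) * (b * x) = c * (h ^- coset_index x * x).
    by rewrite /c -!mulgA mulKVg.
  have Dy : h ^- coset_index (b * y) * (b * y) = c * (h ^- coset_index y * y).
    by rewrite /c -eqbi -eqi -!mulgA mulKVg.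
  rewrite Dx Dy f_inv ?coset_indexP //.
  rewrite -(groupMr _ (coset_indexP A'x)) -Dx coset_indexP ?groupM //.
have modE (N i j k : nat) : k < N ->
    ((i + k) %% N == ((i + j) %% N).+1 %% N) = (k == j.+1 %% N).
  by move=> ltkN; rewrite -addn1 modnDml addn1 -addnS eqn_modDl modn_small.
by rewrite -!val_eqE /= !coset_indexM // modE.
Qed.

End LexLabelling.

(* Automorphisms of D preserve the orbitals (double cosets of S) of the labels. *)
Definition orbital_labelling (gT : finGroupType) (S : {set gT}) (A : {group gT})
    (D : digraph) (f : gT -> vertex D) : Prop :=
  forall w, w \in digraph_aut D ->
  {in A & A, forall x y, {in A & A, forall x' y',
    f x' = w (f x) -> f y' = w (f y) ->
    dcoset_rel S (x^-1 * y) (x'^-1 * y')}}.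

(** The invariant of the induction along a wreath chain. Irreflexivity allows passing to the
    loopless complement; the orbital condition later makes automorphisms of a factor preserve the
    arcs of the ambient digraph. *)
Definition wreath_digraph (gT : finGroupType) (S : {set gT})
    (A B : {group gT}) (D : digraph) (fA fB : gT -> vertex D) : Prop :=
  [/\ irreflexive (@arc D), iterated_wreath_cyclic (digraph_aut D),
      left_invariant_labelling A fA, left_invariant_labelling B fB
    & orbital_labelling S A fA].

Lemma wreath_digraph_compl (gT : finGroupType) (S : {set gT}) (A B : {group gT})
    (D : digraph) (fA fB : gT -> vertex D) :
  wreath_digraph S A B fA fB ->
  wreath_digraph (D := loopless_compl D) S A B fA fB.
Proof.
case=> irrD iterD [injA oA invA] [injB oB invB] orbA.
have autE := aut_loopless_compl irrD; split.
- by move=> x; rewrite /= eqxx.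
- by rewrite autE.
- split=> // b x y Ab Ax Ay /=; rewrite invA //.
  by rewrite (inj_in_eq injA) ?groupM // (inj_in_eq injA) // (inj_eq (mulgI b)).
- split=> // b x y Ab Ax Ay /=; rewrite invB //.
  by rewrite (inj_in_eq injB) ?groupM // (inj_in_eq injB) // (inj_eq (mulgI b)).
by move=> w; rewrite autE; apply: orbA.
Qed.

(** Within a block, differences lie in [A] and the property of [f] applies. Across blocks they lie
    outside [A], and since an automorphism shifts all block indices equally, they change only by an
    element of [A], as the double coset hypothesis allows. *)
Lemma lex_orbital_labelling (gT : finGroupType) (S A A' : {group gT}) (h : gT)
    (n : nat) (D : digraph) (f : gT -> vertex D) :
    abelian A' -> A \subset A' -> h \in A' -> A * <[h]> = A' ->
    #|A' : A| = n.+2 ->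
    (forall y : vertex D, (#|[pred z | arc y z]|).*2 < #|vertex D|) ->
    (forall y k, y \in A' -> y \notin A -> k \in A -> dcoset_rel S y (y * k)) ->
    orbital_labelling S A f ->
  orbital_labelling S A' (lex_label A h n f).
Proof.
move=> abA' sAA' A'h defA' iA small dcA orbA w.
rewrite (aut_cycle_lex _ (f 1) small) inE.
case/exists_inP=> r /cycleP[c ->] /existsP[b /andP[/forallP bD /forallP wE]].
move=> x y A'x A'y x' y' A'x' A'y'; rewrite !(eqP (wE _)) /= => -[ix fx] [iy fy].
have cA' u v : u \in A' -> v \in A' -> u * v = v * u.
  by move=> Au Av; apply: (centsP abA').
pose ci := coset_index A h n.
have iP u : u \in A' -> h ^- ci u * u \in A by apply: coset_indexP.
have [eqi | neqi] := eqVneq (ci x) (ci y).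
  have eqi' : ci x' = ci y' by rewrite /ci ix iy -/ci eqi.
  have Dxy u v : ci u = ci v -> u^-1 * v = (h ^- ci u * u)^-1 * (h ^- ci v * v).
    by move=> ->; rewrite invMg invgK -mulgA mulKVg.
  rewrite (Dxy x y eqi) (Dxy x' y' eqi').
  apply: (orbA _ (bD (ci x))); rewrite ?iP //.
  by rewrite {1}eqi.
have nAxy : x^-1 * y \notin A.
  by rewrite -(coset_index_eq abA' sAA' A'h defA' iA A'x A'y).
have -> : x'^-1 * y' = (x^-1 * y) * ((x' * y)^-1 * (x * y')).
  rewrite invMg !mulgA mulgK (cA' _ _ (groupVr A'x) (groupVr A'x')).
  by rewrite mulgKV.
apply: dcA nAxy _; first by rewrite groupM ?groupV.
rewrite -(coset_index_eq abA' sAA' A'h defA' iA) ?groupM //; apply/eqP/val_inj.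
rewrite /= !(coset_indexM abA' sAA' A'h defA' iA) // ix iy !rotationX.
by rewrite modnDml modnDmr addnAC addnA.
Qed.

Theorem wreath_chain_digraph (gT : finGroupType) (S A B : {group gT}) :
    wreath_chain S A B ->
  exists (D : digraph) (fA fB : gT -> vertex D), wreath_digraph S A B fA fB /\
    exists d, forall y : vertex D, #|[pred z | arc y z]| = d.
Proof.
elim=> {A B} [A B A1 B1 | A B A' B' _ IH sA sB iAB abA abB cycA cycB dcA].
  pose D := @Digraph unit (fun _ _ => false).
  have aut1 : digraph_aut D = 1.
    by apply/trivgP/subsetP=> s _; rewrite inE; apply/eqP/permP=> -[];
    rewrite perm1; case: (s tt).
  have lab (X : {group gT}) :
      X :=: 1 -> left_invariant_labelling (D := D) X (fun _ : gT => tt).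
    move=> X1; split=> //; last by rewrite card_unit X1 cards1.
    by move=> x y; rewrite X1 !inE => /eqP-> /eqP->.
  exists D, (fun=> tt), (fun=> tt); split; last first.
    by exists 0 => y; apply: eq_card0.
  split=> //; [ | exact: lab | exact: lab | ].
    rewrite aut1; apply: (IterWreathOne (A := 1%G)); first exact: cyclic1.
    split=> [|x]; last by rewrite setI1g.
    apply/imsetP; exists tt => //; apply/setP=> -[]; rewrite inE; apply/esym/orbitP.
    by exists 1; rewrite ?inE //= apermE perm1.
  move=> w _ x y Ax Ay x' y' Ax' Ay' _ _; rewrite A1 !inE in Ax Ay Ax' Ay'.
  exists 1, 1; rewrite group1; split=> //.
  by rewrite (eqP Ax) (eqP Ay) (eqP Ax') (eqP Ay') !mulg1 !mul1g.
case: IH => D [fA [fB [wD [d outD]]]].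
(* A trivial factor adds no cycle, since [cycle_lex] has at least two blocks. *)
have [i1 | iA_gt1] := leqP #|A' : A| 1.
  have sub1 (X Y : {group gT}) : X \subset Y -> #|Y : X| <= 1 -> Y = X.
    move=> sXY; rewrite leqNgt indexg_gt1 negbK => sYX.
    by apply: group_inj; apply/eqP; rewrite eqEsubset sXY sYX.
  rewrite (sub1 A A' sA i1) (sub1 B B' sB); last by rewrite -iAB.
  by exists D, fA, fB; split=> //; exists d.
have [n iA] : exists n, #|A' : A| = n.+2.
  by case: #|A' : A| iA_gt1 => [|[|n]] // _; exists n.
have iB : #|B' : B| = n.+2 by rewrite -iAB.
(* D or its loopless complement has out-degree below half of its order, and
   both have the same automorphisms. *)
wlog small : D fA fB wD d outD / d.*2 < #|vertex D| => [IH|].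
  have [|le_d] := ltnP d.*2 #|vertex D|; first exact: IH wD d outD.
  have [irrD _ _ _ _] := wD; have wD' := wreath_digraph_compl wD.
  have outD' (y : vertex D) := outdeg_loopless_compl y irrD.
  apply: IH wD' (#|vertex D| - d.+1)%N _ _ => [y|].
    by rewrite -(outD' y) outD subSS addKn.
  have: 0 < #|vertex D| by apply/card_gt0P; exists (fA 1).
  by move: le_d => /=; move: #|vertex D| => v; clear; lia.
case/(cyclic_quotientP abA sA): cycA => hA A'h defA.
case/(cyclic_quotientP abB sB): cycB => hB B'h defB.
have [irrD iterD labA labB orbA] := wD.
have smallD (y : vertex D) : (#|[pred z | arc y z]|).*2 < #|vertex D|.
  by rewrite outD.
exists (cycle_lex n D), (lex_label A hA n fA), (lex_label B hB n fB); split.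
  split; first by move=> x; rewrite /= eqxx irrD.
  - rewrite (aut_cycle_lex _ (fA 1)) //.
    apply: (IterWreathCons (A := <[rotation n]>%G)) iterD; first exact: cycle_cyclic.
    exact: rotation_regular.
  - exact: lex_label_left_invariant.
  - exact: lex_label_left_invariant.
  exact: lex_orbital_labelling.
by exists (d + #|vertex D|)%N; apply: outdeg_cycle_lex.
Qed.

(** * Sylow decomposition *)

(** Lists permit induction on the indices, splitting off one component at a time, before
    specialising to all of ['I_r]. *)
Definition primes_in (I : eqType) (p : I -> nat) (l : seq I) : nat_pred :=
  [pred q | q \in map p l].

Lemma primes_in_part (I : eqType) (p : I -> nat) (i : I) (l : seq I) (m : nat) :
    0 < m -> (primes_in p (i :: l)).-nat m ->
  (primes_in p l).-nat (m`_(p i)^')%N.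
Proof.
move=> m_gt0 pm; have pm' := pnat_dvd (dvdn_part (p i)^' m) pm.
have: [predI (p i)^' & primes_in p (i :: l)].-nat (m`_(p i)^')%N.
  by rewrite pnatI part_pnat.
by apply: sub_in_pnat => q _; rewrite !inE => /andP[/negPf->].
Qed.

Lemma pnat_primes_in_nil (I : eqType) (p : I -> nat) (m : nat) :
  (primes_in p [::]).-nat m -> m = 1%N.
Proof.
move=> pm; apply: (pnat_1 pm); by apply: sub_in_pnat pm => q _; rewrite !inE.
Qed.

Lemma prod_constt_seq (gT : finGroupType) (I : eqType) (p : I -> nat)
    (l : seq I) (x : gT) :
    injective p -> uniq l -> (primes_in p l).-elt x ->
  \prod_(i <- l) x.`_(p i) = x.
Proof.
move=> p_inj; elim: l x => [|i l IHl] x /=.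
  by move=> _ /pnat_primes_in_nil/eqP; rewrite order_eq1 big_nil => /eqP->.
case/andP=> nil uniq_l px; rewrite big_cons -[RHS](consttC (p i)); congr (_ * _).
rewrite -[RHS]IHl //; last by rewrite /p_elt order_constt primes_in_part.
apply: eq_big_seq => j lj; rewrite sub_in_constt // => q _.
rewrite !inE => /eqP->; rewrite (inj_eq p_inj).
by apply: contraNneq nil => <-.
Qed.

Lemma prod_partn_seq (I : eqType) (p : I -> nat) (l : seq I) (m : nat) :
    injective p -> uniq l -> 0 < m -> (primes_in p l).-nat m ->
  (\prod_(i <- l) m`_(p i))%N = m.
Proof.
move=> p_inj; elim: l m => [|i l IHl] m /=.
  by move=> _ _ /pnat_primes_in_nil->; rewrite big_nil.
case/andP=> nil uniq_l m_gt0 pm; rewrite big_cons -[RHS](partnC (p i) m_gt0).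
congr (_ * _)%N; rewrite -[RHS]IHl ?part_gt0 ?primes_in_part //.
apply: eq_big_seq => j lj; rewrite partn_part // => q.
rewrite !inE => /eqP->; rewrite (inj_eq p_inj).
by apply: contraNneq nil => <-.
Qed.

Lemma primes_in_prod (r : nat) (p a : 'I_r -> nat) :
    (forall i, prime (p i)) ->
  (primes_in p (index_enum 'I_r)).-nat (\prod_(i < r) p i ^ a i)%N.
Proof.
move=> p_pr; elim/big_ind: _ => // [m1 m2 pm1 pm2|i _]; first by rewrite pnatM pm1.
by rewrite pnatX pnatE // inE map_f ?mem_index_enum.
Qed.

Lemma prodgM_commute (gT : finGroupType) (I : eqType) (l : seq I) (u v : I -> gT) :
    uniq l -> (forall i j, i != j -> commute (v i) (u j)) ->
  \prod_(i <- l) (u i * v i) = (\prod_(i <- l) u i) * (\prod_(i <- l) v i).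
Proof.
move=> uniq_l cuv; elim: l uniq_l => [|i l IHl] /=; first by rewrite !big_nil mulg1.
case/andP=> nil uniq_l; rewrite !big_cons IHl //.
have cvi : commute (v i) (\prod_(j <- l) u j).
  rewrite big_seq; elim/big_ind: _ => [|x y|j lj]; [exact: commute1 | exact: commuteM |].
  by apply: cuv; apply: contraNneq nil => ->.
by rewrite -!mulgA (mulgA (v i)) cvi !mulgA.
Qed.

Lemma mem_Sylow_constt (gT : finGroupType) (p : nat) (H Hp : {group gT}) (x : gT) :
  abelian H -> p.-Sylow(H) Hp -> x \in H -> x.`_p \in Hp.
Proof.
move=> abH sylHp Hx; have sxH : <[x]> \subset H by rewrite cycle_subG.
rewrite (mem_normal_Hall sylHp) ?p_elt_constt //.
  by rewrite -sub_abelian_normal // (pHall_sub sylHp).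
exact: subsetP sxH _ (cycle_constt p x).
Qed.

Lemma abelian_consttM (gT : finGroupType) (pi : nat_pred) (H : {group gT}) (x y : gT) :
  abelian H -> x \in H -> y \in H -> (x * y).`_pi = x.`_pi * y.`_pi.
Proof. by move=> abH Hx Hy; apply/consttM/(centsP abH). Qed.

Lemma regular_card (X : finType) (A : {group {perm X}}) :
  regular_permgroup A -> #|A| = #|X|.
Proof.
case=> trA regA; have /imsetP[x _ orbx] := trA.
by rewrite -(card_orbit_stab 'P A x) -orbx regA cards1 muln1 cardsT.
Qed.

Lemma labelling_inverse (gT : finGroupType) (A : {group gT}) (D : digraph)
    (f : gT -> vertex D) :
    left_invariant_labelling A f ->
  exists e : vertex D -> gT, forall v, e v \in A /\ f (e v) = v.
Proof.
case=> f_inj oD _; have [||e eK fK] := @inj_card_bij _ _ (f \o @sgval _ A).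
- by move=> x y /= /(f_inj _ _ (subgP x) (subgP y))/val_inj.
- by rewrite oD card_sub.
by exists (sgval \o e) => v; split; [apply: subgP | apply: fK].
Qed.

Lemma labelling_translation (gT : finGroupType) (A : {group gT}) (D : digraph)
    (f : gT -> vertex D) (k : gT) :
    left_invariant_labelling A f -> k \in A ->
  exists w, w \in digraph_aut D /\ {in A, forall x, w (f x) = f (k * x)}.
Proof.
move=> labf Ak; have [e eP] := labelling_inverse labf.
have [f_inj oD f_inv] := labf.
have wf_inj : injective (fun v => f (k * e v)).
  move=> v1 v2 /f_inj; have [[A1 D1] [A2 D2]] := (eP v1, eP v2).
  by rewrite !groupM // => /(_ isT isT)/mulgI e12; rewrite -D1 -D2 e12.
exists (perm wf_inj); split=> [|x Ax].
  apply/digraph_autP=> v1 v2; rewrite !permE.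
  have [[A1 D1] [A2 D2]] := (eP v1, eP v2).
  by rewrite f_inv // D1 D2.
by rewrite permE; have [Ae /f_inj->] := eP (f x).
Qed.

Lemma isog_cayley_labelling (gT hT : finGroupType) (K : {group gT})
    (L : {group hT}) (D : digraph) :
    K \isog L -> cayley_digraph_on K D ->
  exists f : hT -> vertex D, left_invariant_labelling L f.
Proof.
rewrite isog_sym => isoLK [S sSK [g g_bij g_arc]].
have oD : #|vertex D| = #|K| by rewrite -(bij_eq_card g_bij) card_sub.
have [m inj_m im_m] := isogP isoLK.
have mK x : x \in L -> m x \in K by move=> Lx; rewrite -im_m mem_morphim.
exists (fun x => g (subg K (m x))); split.
- move=> x y Lx Ly /(bij_inj g_bij)/(congr1 sgval); rewrite !subgK ?mK //.
  exact: (injmP inj_m).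
- by rewrite oD (card_isog isoLK).
move=> b x y Lb Lx Ly; rewrite !g_arc /= !subgK ?mK ?groupM //.
apply: eq_existsb => s; rewrite !morphM // -mulgA.
by rewrite (inj_eq (mulgI _)).
Qed.

(** * Gluing the Sylow factors: the two implications *)

Section Assembly.

Variables (r : nat) (p a : 'I_r -> nat) (D : digraph).
Hypotheses (p_prime : forall i, prime (p i)) (p_inj : injective p).
Hypothesis degree_D : #|vertex D| = (\prod_(i < r) p i ^ a i)%N.

Lemma regular_constt_prod (A : {group {perm vertex D}}) x :
  regular_permgroup A -> x \in A -> \prod_(i < r) x.`_(p i) = x.
Proof.
move=> regA Ax; apply: prod_constt_seq => //; first exact: index_enum_uniq.
apply: (pnat_dvd (order_dvdG Ax)); rewrite regular_card // degree_D.
exact: primes_in_prod.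
Qed.

Lemma regular_constt_inj (A : {group {perm vertex D}}) x y :
    regular_permgroup A -> x \in A -> y \in A ->
  (forall i, x.`_(p i) = y.`_(p i)) -> x = y.
Proof.
move=> regA Ax Ay eq_xy.
rewrite -(regular_constt_prod regA Ax) -(regular_constt_prod regA Ay).
exact: eq_bigr.
Qed.

(** Vertices are labelled through the Sylow components of elements of [H]. A translation by [H] acts
    on each coordinate as an automorphism of [Ds i], so the product type makes it preserve arcs. *)
Lemma product_type_cayley (H : {group {perm vertex D}})
    (Hp : 'I_r -> {group {perm vertex D}}) (Ds : 'I_r -> digraph) :
    regular_permgroup H -> abelian H -> (forall i, (p i).-Sylow(H) (Hp i)) ->
    product_type D Ds ->
    (forall i, exists f : {perm vertex D} -> vertex (Ds i),
       left_invariant_labelling (Hp i) f) ->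
  cayley_digraph_on H D.
Proof.
move=> regH abH sylH [phi phi_bij phi_arc] /fin_all_exists[f f_lab].
pose F h := phi [ffun i => f i h.`_(p i)].
have memHp h i : h \in H -> h.`_(p i) \in Hp i.
  exact: mem_Sylow_constt abH (sylH i).
apply: (@left_invariant_cayley _ H D F); split.
- move=> x y Hx Hy /(bij_inj phi_bij)/ffunP eqf.
  apply: (regular_constt_inj regH) => // i; have [f_inj _ _] := f_lab i.
  by apply: f_inj; rewrite ?memHp //; have := eqf i; rewrite !ffunE.
- by rewrite regular_card.
move=> b x y Hb Hx Hy.
have [w wP] := fin_all_exists (fun i => labelling_translation (f_lab i) (memHp b i Hb)).
rewrite -[RHS](phi_arc w) => [|i]; last by have [] := wP i.
have FE z : z \in H -> F (b * z) = phi [ffun i => w i ([ffun i => f i z.`_(p i)] i)].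
  move=> Hz; congr phi; apply/ffunP=> i; rewrite !ffunE.
  have [_ ->] := wP i; last exact: memHp.
  by rewrite (abelian_consttM _ abH).
by rewrite !FE.
Qed.

Section Nilpotent.

Variables (N G H : {group {perm vertex D}}).
Hypotheses (nilN : nilpotent N) (N_aut : N \subset digraph_aut D).

Let P i := 'O_(p i)(N)%G.

(** As [P i] is a normal Hall subgroup, its point stabiliser is a Sylow subgroup of the stabiliser
    in [N]. Since the order of [N] is that of [X] times that of the stabiliser, comparing
    [p i]-parts gives the factorisation. *)
Lemma regular_Sylow_factor (x0 : vertex D) (X Xp : {group {perm vertex D}}) i :
    X \subset N -> regular_permgroup X -> (p i).-Sylow(X) Xp ->
  Xp * 'C_(P i)[x0 | 'P] = P i /\ Xp :&: 'C_(P i)[x0 | 'P] = 1.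
Proof.
move=> sXN regX sylXp; have [trX stX] := regX.
have sXpX := pHall_sub sylXp; have sXpN := subset_trans sXpX sXN.
have hallP := nilpotent_pcore_Hall (p i) nilN.
have sXpP : Xp \subset P i.
  by rewrite (sub_normal_Hall hallP) ?pcore_normal ?(pHall_pgroup sylXp).
have tiX : Xp :&: 'C_(P i)[x0 | 'P] = 1.
  apply/trivgP; rewrite -(stX x0) setISS ?subsetIr //.
split=> //; apply/eqP; rewrite eqEcard mul_subG ?subsetIl // andTb TI_cardMg //.
have orbN : orbit 'P N x0 = [set: vertex D].
  apply/eqP; rewrite eqEsubset subsetT -(atransP trX x0 (in_setT _)).
  by rewrite imsetS.
have oN : (#|X| * #|'C_N[x0 | 'P]| = #|N|)%N.
  by rewrite -(card_orbit_stab 'P N x0) orbN cardsT (regular_card regX).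
have stE : 'C_(P i)[x0 | 'P] = P i :&: 'C_N[x0 | 'P].
  by rewrite setIA (setIidPl (pcore_sub _ _)).
have hallS := setI_normal_Hall (pcore_normal (p i) N) hallP (subsetIl N 'C[x0 | 'P]).
have oS : #|'C_(P i)[x0 | 'P]| = (#|'C_N[x0 | 'P]|`_(p i))%N.
  by rewrite stE (card_Hall hallS).
apply: eq_leq; rewrite (card_Hall sylXp) [RHS](congr2 muln erefl oS).
by rewrite -partnM ?cardG_gt0 // oN (card_Hall hallP).
Qed.

Lemma pcore_commute i j x y : i != j -> x \in P i -> y \in P j -> commute x y.
Proof.
move=> neq_ij Px Py.
have co_ij : coprime #|P i| #|P j|.
  apply: (@pnat_coprime (p i)); first exact: pcore_pgroup.
  apply: sub_in_pnat (pcore_pgroup (p j) N) => q _; rewrite !inE => /eqP->.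
  by rewrite (inj_eq p_inj) eq_sym.
have := sub_nilpotent_cent2 nilN (pcore_sub (p i) N) (pcore_sub (p j) N) co_ij.
by move/centsP/(_ y Py x Px)/commute_sym.
Qed.

Hypotheses (G_regular : regular_permgroup G) (sGN : G \subset N).
Hypothesis (abG : abelian G).

(** Components at different primes commute, so the relations multiply to [q' = s * q * t] with [s]
    and [t] fixing [x0], and [t] is an automorphism. *)
Lemma dcoset_constt_arc (x0 : vertex D) q q' : q \in G -> q' \in G ->
    (forall i, dcoset_rel 'C_(P i)[x0 | 'P] q.`_(p i) q'.`_(p i)) ->
  arc x0 (q' x0) = arc x0 (q x0).
Proof.
move=> Gq Gq' /fin_all_exists[s /fin_all_exists[t stP]].
have qP z i : z \in G -> z.`_(p i) \in P i.
  move=> Gz; rewrite (mem_normal_Hall (nilpotent_pcore_Hall (p i) nilN)).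
  - exact: p_elt_constt.
  - exact: pcore_normal.
  by apply: subsetP (subset_trans _ sGN) _ (cycle_constt _ z); rewrite cycle_subG.
have sS i : 'C_(P i)[x0 | 'P] \subset P i by apply: subsetIl.
have sC i : 'C_(P i)[x0 | 'P] \subset 'C_N[x0 | 'P].
  by rewrite setSI // pcore_sub.
have Ps i : s i \in P i by have [/(subsetP (sS i))] := stP i.
have Pt i : t i \in P i by have [_ /(subsetP (sS i))] := stP i.
have Dq' : q' = (\prod_i s i) * q * (\prod_i t i).
  rewrite -(regular_constt_prod G_regular Gq') -(regular_constt_prod G_regular Gq).
  rewrite -!prodgM_commute ?index_enum_uniq //.
  - by apply: eq_bigr => i _; have [_ _] := stP i.
  - by move=> i j neq_ij; apply: pcore_commute neq_ij _ _; rewrite ?qP ?groupM ?qP.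
  by move=> i j neq_ij; apply: pcore_commute neq_ij _ _; rewrite ?groupM ?qP.
have fixS u : (forall i, u i \in 'C_(P i)[x0 | 'P]) ->
    \prod_i u i \in N /\ (\prod_i u i) x0 = x0.
  move=> uP; have: \prod_i u i \in 'C_N[x0 | 'P].
    by apply: group_prod => i _; apply: subsetP (sC i) _ (uP i).
  by case/setIP=> Nu /astab1P.
have [_ sx0] := fixS s (fun i => let: And3 h _ _ := stP i in h).
have [Nt tx0] := fixS t (fun i => let: And3 _ h _ := stP i in h).
have /digraph_autP tA := subsetP N_aut _ Nt.
by rewrite Dq' !permM sx0 -{1}tx0 tA.
Qed.

Hypotheses (H_regular : regular_permgroup H) (sHN : H \subset N).
Hypotheses (cycG : cyclic G) (abH : abelian H).
Variables (Gp Hp : 'I_r -> {group {perm vertex D}}).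
Hypothesis Gp_Sylow : forall i, (p i).-Sylow(G) (Gp i).
Hypothesis Hp_Sylow : forall i, (p i).-Sylow(H) (Hp i).

Lemma nilpotent_wreath_product_type :
  exists Ds : 'I_r -> digraph, cayley_product_type D Gp Hp Ds /\
    forall i, multiwreath_of_cyclic (digraph_aut (Ds i)).
Proof.
have [trG stG] := G_regular; have /imsetP[x0 _ orbG] := trG.
have /fin_all_exists[Ds] : forall i, exists D' : digraph,
    exists fA fB : {perm vertex D} -> vertex D',
      wreath_digraph 'C_(P i)[x0 | 'P] (Gp i) (Hp i) fA fB.
  move=> i; have [defG tiG] := regular_Sylow_factor x0 sGN G_regular (Gp_Sylow i).
  have [defH tiH] := regular_Sylow_factor x0 sHN H_regular (Hp_Sylow i).
  have cycGp := cyclicS (pHall_sub (Gp_Sylow i)) cycG.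
  have abHp := abelianS (pHall_sub (Hp_Sylow i)) abH.
  have chain := pgroup_wreath_chain (p_prime i) (pcore_pgroup _ N)
    cycGp abHp defG defH tiG tiH.
  have [D' [fA [fB [wD _]]]] := wreath_chain_digraph chain.
  by exists D', fA, fB.
case/fin_all_exists=> fA /fin_all_exists[fB wD].
exists Ds; split=> [|i]; last first.
  have [_ iterD _ _ _] := wD i; exists (vertex (Ds i)), (digraph_aut (Ds i)).
  split=> //; exists id; first by exists id.
  by move=> s t st; have -> : t = s by apply/permP=> x; apply: st.
split; last first.
  move=> i; have [_ _ labA labB _] := wD i.
  split; first exact: left_invariant_cayley labA.
  exists _, (Hp i); split; first exact: isog_refl.
  exact: left_invariant_cayley labB.
(* Each vertex is named by the element of [G] carrying [x0] to it; [psi] reads off the labels of its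
   Sylow components. *)
have /fin_all_exists[g gP] : forall v : vertex D, exists g, g \in G /\ g x0 = v.
  move=> v; have: v \in orbit 'P G x0 by rewrite -orbG.
  by case/orbitP=> g Gg <-; exists g.
pose psi v : {dffun forall i : 'I_r, vertex (Ds i)} := [ffun i => fA i (g v).`_(p i)].
have memGp x i : x \in G -> x.`_(p i) \in Gp i.
  exact: mem_Sylow_constt abG (Gp_Sylow i).
have psi_inj : injective psi.
  move=> u v /ffunP eq_uv; have [[Gu Du] [Gv Dv]] := (gP u, gP v).
  rewrite -Du -Dv; congr (fun_of_perm _ x0).
  apply: (regular_constt_inj G_regular) => // i; have [_ _ [f_inj _ _] _ _] := wD i.
  by apply: f_inj; rewrite ?memGp //; have := eq_uv i; rewrite !ffunE.
have [|phi psiK phiK] := inj_card_bij psi_inj.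
  rewrite card_dep_ffun foldrE big_map big_enum /=.
  rewrite (eq_bigr (fun i => #|G|`_(p i))%N); last first.
    by move=> i _; have [_ _ [_ -> _] _ _] := wD i; rewrite (card_Hall (Gp_Sylow i)).
  rewrite prod_partn_seq ?index_enum_uniq ?cardG_gt0 ?regular_card //.
  by rewrite degree_D primes_in_prod.
exists phi; first by exists psi.
move=> w wA x y.
have fE (z : {dffun forall i : 'I_r, vertex (Ds i)}) i : fA i (g (phi z)).`_(p i) = z i.
  by rewrite -{2}(phiK z) ffunE.
(* Since [G] is abelian and acts by automorphisms, adjacency depends only on the quotient of the two
   names. *)
have arcE u v : arc u v = arc x0 (((g u)^-1 * g v) x0).
  have [[Gu Du] [Gv Dv]] := (gP u, gP v).
  have /digraph_autP guA := subsetP N_aut _ (groupVr (subsetP sGN _ Gu)).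
  rewrite (centsP abG _ (groupVr Gu) _ Gv) permM Dv.
  by rewrite -[LHS]guA; congr (arc _ _); rewrite -{2}Du permK.
rewrite !(arcE (phi _)).
have gG z : g z \in G by have [] := gP z.
apply: dcoset_constt_arc; rewrite ?groupM ?groupV // => i.
rewrite !(abelian_consttM _ abG) ?groupV // !consttV.
(* On each coordinate [w i] keeps the quotient of the two labels in its double coset. *)
have [_ _ _ _ orbA] := wD i; apply: (orbA (w i) (wA i)); rewrite ?memGp //.
  by rewrite !fE ffunE.
by rewrite !fE ffunE.
Qed.

End Nilpotent.

End Assembly.

Close Scope group_scope.

Theorem theorem3p7 (n r : nat) (p a : 'I_r -> nat) (D : digraph)
    (G H : {group {perm vertex D}}) (Gp Hp : 'I_r -> {group {perm vertex D}})
    (p_prime : forall i, prime (p i)) (p_inj : injective p)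
    (n_def : n = \prod_(i < r) p i ^ a i)
    (degree_n : #|vertex D| = n)
    (G_regular : regular_permgroup G) (H_regular : regular_permgroup H)
    (G_cyclic : cyclic G) (H_abelian : abelian H)
    (Gp_Sylow : forall i, ((p i).-Sylow(G) (Gp i))%g)
    (Hp_Sylow : forall i, ((p i).-Sylow(H) (Hp i))%g)
    (D_cayley : cayley_digraph_on G D)
    (G_aut : G \subset digraph_aut D) :
  ((exists Ds : 'I_r -> digraph, cayley_product_type D Gp Hp Ds) ->
     cayley_digraph_on H D)
  /\
  ((exists N : {group {perm vertex D}},
      [/\ nilpotent N, G \subset N, H \subset N & N \subset digraph_aut D]) ->
   exists Ds : 'I_r -> digraph,
     cayley_product_type D Gp Hp Ds /\
     forall i, multiwreath_of_cyclic (digraph_aut (Ds i))).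
Proof.
have degree_D : #|vertex D| = (\prod_(i < r) p i ^ a i)%N by rewrite degree_n.
split=> [[Ds [prodD Ds_cayley]] | [N [nilN sGN sHN N_aut]]].
  apply: (product_type_cayley p_prime p_inj degree_D H_regular H_abelian
            Hp_Sylow prodD) => i.
  have [_ [gT [K [isoKH KD]]]] := Ds_cayley i.
  exact: isog_cayley_labelling isoKH KD.
exact: (nilpotent_wreath_product_type p_prime p_inj degree_D nilN N_aut
  G_regular sGN (cyclic_abelian G_cyclic) H_regular sHN).
Qed.
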